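(* Let $X$ be a nontrivial mm-space of finite diameter and let $1\le p\le+\infty$. Assume that $\inf_{x,y\in X,\ x\ne y} d_X(x,y)>0$ if $1<p<+\infty$. Then $\{X_p^n\}_{n=1}^\infty$ has the phase transition property with critical scale order $\sim n^{-\frac{1}{2p}}$, i.e., for any sequence $\{t_n\}_{n=1}^\infty$ of positive real numbers: (1) if $n^{\frac{1}{2p}}t_n\to 0$ as $n\to\infty$, then $\{t_nX_p^n\}_{n=1}^\infty$ is a Lévy family; (2) if $n^{\frac{1}{2p}}t_n\to+\infty$ as $n\to\infty$, then $\{t_nX_p^n\}_{n=1}^\infty$ $\infty$-dissipates. Here, for $p=+\infty$, $n^{\frac{1}{2p}}$ is understood as $1$.
   Context: An mm-space is a space $X$ equipped with a complete separable metric $d_X$ and a Borel probability measure $\mu_X$ on $X$. It is nontrivial if $\mu_X$ is not a Dirac measure, i.e. the support of $\mu_X$ has at least two points. For $t>0$, $tX$ denotes the mm-space $X$ with the scaled metric $d_{tX}:=t\,d_X$ and the same measure. $l_p$-product: for $1\le p\le+\infty$ and $n\ge 1$, $X_p^n := (X^n, d_{X_p^n}, \mu_X^{\otimes n})$, where for $x=(x_1,\dots,x_n), y=(y_1,\dots,y_n)\in X^n$ we put $d_{X_p^n}(x,y) := \left(\sum_{i=1}^n d_X(x_i,y_i)^p\right)^{1/p}$ if $p<+\infty$ and $d_{X_\infty^n}(x,y):=\max_{1\le i\le n}d_X(x_i,y_i)$, and $\mu_X^{\otimes n}$ is the product measure. Partial diameter: for an mm-space $X$ and a real number $\alpha$,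 $\operatorname{diam}(X;\alpha)=\operatorname{diam}(\mu_X;\alpha)$ is the infimum of $\operatorname{diam}(A)$ over all Borel subsets $A\subset X$ with $\mu_X(A)\ge \alpha$. Observable diameter: for $\kappa>0$, $\operatorname{ObsDiam}(X;-\kappa)$ is the supremum of $\operatorname{diam}(f_*\mu_X;1-\kappa)$ over all $1$-Lipschitz functions $f:X\to\mathbb{R}$, where $f_*\mu_X$ is the push-forward measure on $\mathbb{R}$; it is $0$ for $\kappa\ge 1$. Separation distance: for $N\ge1$ and $\kappa_0,\dots,\kappa_N>0$, $\operatorname{Sep}(X;\kappa_0,\dots,\kappa_N)$ is the supremum of $\min_{i\ne j}d_X(A_i,A_j)$ over all sequences of Borel subsets $A_0,\dots,A_N\subset X$ with $\mu_X(A_i)\ge\kappa_i$ for all $i$, where $d_X(A_i,A_j):=\inf_{x\in A_i,\,y\in A_j}d_X(x,y)$; it is defined to be $0$ if no such sequence exists. A sequence $\{X_n\}$ of mm-spaces is a Lévy family if $\lim_{n\to\infty}\operatorname{ObsDiam}(X_n;-\kappa)=0$ for every $\kappa>0$. It $\infty$-dissipates if $\lim_{n\to\infty}\operatorname{Sep}(X_n;\kappa_0,\dots,\kappa_N)=+\infty$ for every $N\ge1$ and all $\kappa_0,\dots,\kappa_N>0$ with $\sum_{i=0}^N\kappa_i<1$. *)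

(* Defs.v *)
From HB Require Import structures.
From mathcomp Require Import all_boot all_order all_algebra.
From mathcomp Require Import all_classical all_reals all_analysis.
Set Implicit Arguments.
Unset Strict Implicit.
Unset Printing Implicit Defensive.
Import Order.TTheory GRing.Theory Num.Theory.
Import numFieldNormedType.Exports.
Import metricType_numDomainType.
Local Open Scope classical_set_scope.
Local Open Scope ring_scope.

#[short(type="completeMetricType")]
HB.structure Definition CompleteMetric (R : numDomainType) :=
  {T of CompletePseudoMetric R T & Metric R T}.

Notation borelType T := (g_sigma_algebraType (@open T)).

Record mmSpace (R : realType) := MMSpace {
  mm_sort :> completeMetricType R ;
  mm_separable : exists2 D : set mm_sort, countable D & dense D ;
  mm_prob : probability (borelType mm_sort) R }.

Section invariants.
Local Open Scope ereal_scope.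
Context {R : realType}.

(* the point 0 only matters for A = set0, whose diameter is 0 by convention *)
Definition diam (T : metricType R) (A : set T) : \bar R :=
  ereal_sup (0 |` [set (mdist x y)%:E | x in A & y in A]).

Definition partial_diam (T : metricType R) (mu : set T -> \bar R) (a : R) :
    \bar R :=
  ereal_inf [set diam A | A in [set A | <<s open>> A /\ a%:E <= mu A]].

Definition lipschitz1 (T : metricType R) (f : T -> R) : Prop :=
  forall x y, (`|f x - f y| <= mdist x y)%R.

(* For kappa >= 1 the value is 0, since set0 is then admissible in
   partial_diam. *)
Definition ObsDiam (X : mmSpace R) (kappa : R) : \bar R :=
  ereal_sup [set partial_diam (T := R^o)
    (pushforward (mm_prob X) (f : borelType X -> borelType R^o)) (1 - kappa)
    | f in @lipschitz1 X].

Definition set_dist (T : metricType R) (A B : set T) : \bar R :=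
  ereal_inf [set (mdist x y)%:E | x in A & y in B].

(* kappa_0, ..., kappa_N are indexed by 'I_N.+1; adjoining the point 0, which
   is below all the other (nonnegative) elements, gives the value 0 when no
   admissible family (A_i) exists. *)
Definition Sep (X : mmSpace R) (N : nat) (kappa : 'I_N.+1 -> R) : \bar R :=
  ereal_sup (0 |` [set \big[mine/+oo]_(ij : 'I_N.+1 * 'I_N.+1 | ij.1 != ij.2)
                         set_dist (A ij.1) (A ij.2)
    | A in [set A : 'I_N.+1 -> set X |
        forall i, <<s open>> (A i) /\ (kappa i)%:E <= mm_prob X (A i)]]).

Definition Levy_family (X : nat -> mmSpace R) : Prop :=
  forall kappa : R, (0 < kappa)%R ->
    (fun n => ObsDiam (X n) kappa) @ \oo --> 0.

Definition infty_dissipates (X : nat -> mmSpace R) : Prop :=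
  forall (N : nat) (kappa : 'I_N.+1 -> R), (1 <= N)%N ->
    (forall i, 0 < kappa i)%R -> (\sum_i kappa i < 1)%R ->
    (fun n => Sep (X n) kappa) @ \oo --> +oo.

Definition nontrivial (X : mmSpace R) : Prop :=
  ~ exists x : borelType X, forall A, measurable A -> mm_prob X A = \d_x A.

End invariants.

Section scaling.
Context {R : realType}.

Definition scaled (X : Type) (t : {posnum R}) : Type := X.

Section metric.
Variables (X : completeMetricType R) (t : {posnum R}).

HB.instance Definition _ := Pointed.on (scaled X t).

Let sdist (x y : scaled X t) : R := t%:num * mdist (x : X) (y : X).

Let sdistxx x : sdist x x = 0.
Proof. by rewrite /sdist mdistxx mulr0. Qed.

Let sdist_positivity x y : sdist x y = 0 -> x = y.
Proof.
by move=> /eqP; rewrite mulf_eq0 gt_eqF//= => /eqP; exact: mdist_positivity.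
Qed.

Let sdist_sym x y : sdist x y = sdist y x.
Proof. by rewrite /sdist metric_sym. Qed.

Let sdist_triangle y x z : sdist x z <= sdist x y + sdist y z.
Proof. by rewrite /sdist -mulrDr ler_pM2l// metric_triangle. Qed.

HB.instance Definition _ := isMetric.Build R (scaled X t)
  sdistxx sdist_positivity sdist_sym sdist_triangle.

Lemma scaled_mdistE (x y : X) :
  mdist (x : scaled X t) (y : scaled X t) = t%:num * mdist x y.
Proof. by []. Qed.

Lemma scaled_nbhsE (x : X) : nbhs (x : scaled X t) = nbhs x.
Proof.
rewrite -[LHS]filter_from_mdist_nbhs -[RHS]filter_from_mdist_nbhs.
apply/seteqP; split=> A [e /= e0 eA].
  exists (t%:num^-1 * e); first by rewrite mulr_gt0 ?invr_gt0.
  by move=> y /= xy; apply: eA; rewrite /= scaled_mdistE -ltr_pdivlMl.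
exists (t%:num * e); first by rewrite mulr_gt0.
by move=> y /=; rewrite scaled_mdistE ltr_pM2l//; exact: eA.
Qed.

Lemma scaled_openE : @open (scaled X t) = @open X.
Proof.
rewrite !openE; apply/funext => A; apply/propext.
by split=> AA x Ax; have := AA x Ax; rewrite /interior scaled_nbhsE.
Qed.

Let scaled_complete (F : set_system (scaled X t)) :
  ProperFilter F -> cauchy F -> cvg F.
Proof.
move=> FF /cauchy_ballP cF; apply/cvg_ex.
have : cauchy (F : set_system X).
  apply/cauchy_ballP => e e0; have := cF (t%:num * e).
  rewrite mulr_gt0// => /(_ isT) [[A B] /= [FA FB] AB].
  exists (A, B) => // -[x y] /AB /=.
  by rewrite !ballEmdist/= scaled_mdistE ltr_pM2l.
move=> /cauchy_cvgP /cvg_ex[l Fl]; exists l => A.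
by rewrite scaled_nbhsE; exact: Fl.
Qed.

HB.instance Definition _ := Uniform_isComplete.Build (scaled X t)
  scaled_complete.

Definition to_scaled (x : borelType X) : borelType (scaled X t) := x.

Lemma measurable_to_scaled : measurable_fun setT to_scaled.
Proof.
move=> _ A mA; rewrite setTI.
by move: mA; rewrite /measurable/= scaled_openE.
Qed.

HB.instance Definition _ :=
  isMeasurableFun.Build _ _ _ _ to_scaled measurable_to_scaled.

End metric.

Lemma scaled_separable (X : mmSpace R) (t : {posnum R}) :
  exists2 D : set (scaled X t), countable D & dense D.
Proof.
have [D cD dD] := mm_separable X; exists D => // O O0.
by rewrite scaled_openE; exact: dD.
Qed.

(* the law of the identity map is mm_prob X itself *)
Definition scale_mm (t : {posnum R}) (X : mmSpace R) : mmSpace R :=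
  MMSpace (scaled_separable X t) (distribution (mm_prob X) (@to_scaled X t)).

End scaling.

Section power_measure.
Context d (T : measurableType d) {R : realType} (P : probability T R).

Definition tuple_cons n (x : T * n.-tuple T) : n.+1.-tuple T :=
  [tuple of x.1 :: x.2].

Lemma measurable_tuple_cons n : measurable_fun setT (@tuple_cons n).
Proof. exact: measurable_cons. Qed.

HB.instance Definition _ n :=
  isMeasurableFun.Build _ _ _ _ (@tuple_cons n) (@measurable_tuple_cons n).

Fixpoint power_prob n : probability (n.-tuple T) R :=
  if n is n'.+1 then
    distribution (product_measure1 P (power_prob n')) (@tuple_cons n')
  else dirac [tuple].

Lemma power_probE n (A : 'I_n -> set T) : (forall i, measurable (A i)) ->
  power_prob n [set x | forall i, A i (tnth x i)] = (\prod_(i < n) P (A i))%E.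
Proof.
elim: n A => [|n IH] A mA /=.
  by rewrite big_ord0 diracE mem_set// => -[].
rewrite /distribution /pushforward big_ord_recl -IH//.
rewrite -product_measure1E//; last first.
  rewrite (_ : [set x | _] =
    \bigcap_(i in [set: 'I_n]) ((@tnth n T ^~ i) @^-1` A (lift ord0 i))).
    apply: fin_bigcap_measurable => // i _.
    by rewrite -[X in measurable X]setTI; exact: measurable_tnth.
  by apply/seteqP; split=> x /= Ax i; [move=> _|]; exact: Ax.
congr product_measure1; apply/seteqP; split=> -[x y] /=.
  move=> Axy; split; first by have := Axy ord0.
  by move=> i; have := Axy (lift ord0 i); rewrite tnthS.
move=> [Ax Ay] i; case: (unliftP ord0 i) => [j|] ->; last by [].
by rewrite tnthS.
Qed.

End power_measure.

Section lp_norm.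
Context {R : realType}.

(* [- oo] is outside the intended range 1 <= p <= +oo *)
Definition lp_norm (p : \bar R) n (a : 'I_n -> R) : R :=
  if p is r%:E then (\sum_i a i `^ r) `^ r^-1 else \big[Num.max/0]_i a i.

Variables (p : \bar R) (p1 : (1 <= p)%E) (n : nat).
Implicit Types a b c : 'I_n -> R.

Lemma lp_norm0 a : (forall i, a i = 0) -> lp_norm p a = 0.
Proof.
move=> a0; rewrite /lp_norm; case: p p1 => [r| |]//.
  rewrite lee_fin => r1; have r0 : r != 0 by rewrite gt_eqF// (lt_le_trans _ r1).
  by rewrite big1 ?powR0 ?invr_eq0// => i _; rewrite a0 powR0.
by move=> _; apply: (big_ind (fun x => x = 0)) => // x y -> ->; rewrite maxxx.
Qed.

Lemma lp_norm_ge0 a : 0 <= lp_norm p a.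
Proof.
rewrite /lp_norm; case: p => [r| |]; rewrite ?powR_ge0//;
by apply: bigmax_ge_id.
Qed.

Lemma lp_norm_coord a i : (forall i, 0 <= a i) -> a i <= lp_norm p a.
Proof.
move=> a0; rewrite /lp_norm; case: p p1 => [r r1|_|//]; last first.
  exact: le_bigmax.
rewrite lee_fin in r1; have r0 : 0 < r by rewrite (lt_le_trans _ r1).
rewrite -[leLHS]powRr1// -(@mulfV _ r) ?gt_eqF// powRrM.
apply: ge0_ler_powR; rewrite ?invr_ge0 ?nnegrE ?powR_ge0 ?(ltW r0)//.
  by apply: sumr_ge0 => *; rewrite powR_ge0.
by rewrite (bigD1 i)//= lerDl sumr_ge0// => *; rewrite powR_ge0.
Qed.

Lemma lp_norm_le_sum a : (forall i, 0 <= a i) -> lp_norm p a <= \sum_i a i.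
Proof.
move=> a0; have S0 : 0 <= \sum_i a i by exact: sumr_ge0.
have aS i : a i <= \sum_i a i.
  by rewrite (bigD1 i)//= lerDl sumr_ge0.
rewrite /lp_norm; case: p p1 => [r r1|_|//]; last first.
  by apply/bigmax_leP; split.
rewrite lee_fin in r1; have r0 : 0 < r by rewrite (lt_le_trans _ r1).
rewrite -[leRHS]powRr1// -(@mulfV _ r) ?gt_eqF// powRrM.
apply: ge0_ler_powR; rewrite ?invr_ge0 ?nnegrE ?powR_ge0 ?(ltW r0)//.
  by apply: sumr_ge0 => *; rewrite powR_ge0.
rewrite -[leRHS]mulr_powRB1// mulr_suml ler_sum// => i _.
rewrite -[leLHS]mulr_powRB1// ler_wpM2l//.
by apply: ge0_ler_powR; rewrite ?nnegrE ?subr_ge0.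
Qed.

Lemma le_lp_norm a b : (forall i, 0 <= a i) -> (forall i, a i <= b i) ->
  lp_norm p a <= lp_norm p b.
Proof.
move=> a0 ab; rewrite /lp_norm; case: p p1 => [r r1|_|//]; last first.
  exact: le_bigmax2.
rewrite lee_fin in r1; have r0 : 0 < r by rewrite (lt_le_trans _ r1).
have b0 i : 0 <= b i by exact: le_trans (ab i).
apply: ge0_ler_powR; rewrite ?invr_ge0 ?nnegrE ?(ltW r0)//;
  try by apply: sumr_ge0 => *; rewrite powR_ge0.
apply: ler_sum => i _; apply: ge0_ler_powR; rewrite ?nnegrE ?(ltW r0)//.
Qed.

Lemma lp_normD a b : (forall i, 0 <= a i) -> (forall i, 0 <= b i) ->
  lp_norm p (fun i => a i + b i) <= lp_norm p a + lp_norm p b.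
Proof.
move=> a0 b0; have := lp_norm_ge0 a; have := lp_norm_ge0 b.
have := @lp_norm_coord a ^~ a0; have := @lp_norm_coord b ^~ b0.
rewrite /lp_norm; case: p p1 => [r r1|_|//]; last first.
  move=> bB aA B0 A0; apply/bigmax_leP; split; first exact: addr_ge0.
  by move=> i _; exact: lerD.
rewrite lee_fin in r1.
have r0 : 0 < r by rewrite (lt_le_trans _ r1).
have N (c : 'I_n -> R) : ((\sum_i c i `^ r) `^ r^-1) `^ r = \sum_i c i `^ r.
  rewrite -powRrM mulVf ?gt_eqF// powRr1//.
  by apply: sumr_ge0 => *; rewrite powR_ge0.
have := N a; have := N b.
set B := _ `^ r^-1; set A := _ `^ r^-1 => NB NA bB aA B0 A0.
have defA : A = (\sum_i a i `^ r) `^ r^-1 by [].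
have defB : B = (\sum_i b i `^ r) `^ r^-1 by [].
clearbody A B.
move: A0; rewrite le_eqVlt => /predU1P[A0|A0].
  have a_0 i : a i = 0.
    by apply/le_anti; rewrite a0 andbT (le_trans (aA i))// -A0.
  by rewrite -A0 add0r defB; under eq_bigr do rewrite a_0 add0r; exact: lexx.
move: B0; rewrite le_eqVlt => /predU1P[B0|B0].
  have b_0 i : b i = 0.
    by apply/le_anti; rewrite b0 andbT (le_trans (bB i))// -B0.
  by rewrite -B0 addr0 defA; under eq_bigr do rewrite b_0 addr0; exact: lexx.
have S0 : 0 < A + B by rewrite addr_gt0.
have [A0' B0' S0'] := And3 (ltW A0) (ltW B0) (ltW S0).
have -> : A + B = ((A + B) `^ r) `^ r^-1.
  by rewrite -powRrM mulfV ?gt_eqF// powRr1.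
apply: ge0_ler_powR; rewrite ?invr_ge0 ?nnegrE ?powR_ge0 ?(ltW r0)//.
  by apply: sumr_ge0 => *; rewrite powR_ge0.
pose w := A / (A + B).
have w01 : 0 <= w <= 1.
  by rewrite divr_ge0//= ler_pdivrMr// mul1r lerDl.
have w1 : 1 - w = B / (A + B).
  by rewrite /w -{1}(@divff _ (A + B)) ?gt_eqF// -mulrBl addrC addKr.
have key i : (a i + b i) `^ r <=
    (A + B) `^ r * (w * (a i / A) `^ r + (1 - w) * (b i / B) `^ r).
  have -> : a i + b i = (A + B) * (w * (a i / A) + (1 - w) * (b i / B)).
    rewrite w1 /w mulrDr; congr (_ + _).
      by rewrite mulrA [_ * (A / _)]mulrC divfK ?gt_eqF// mulrC divfK ?gt_eqF.
    by rewrite mulrA [_ * (B / _)]mulrC divfK ?gt_eqF// mulrC divfK ?gt_eqF.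
  have ci0 : 0 <= w * (a i / A) + (1 - w) * (b i / B).
    by rewrite w1 addr_ge0// mulr_ge0// divr_ge0.
  rewrite powRM// ler_wpM2l ?powR_ge0//.
  have /(_ (Itv01 (andP w01).1 (andP w01).2) (a i / A) (b i / B)) :=
    convex_powR r1.
  rewrite !inE/= !in_itv/= !andbT !divr_ge0// => /(_ isT isT).
  by rewrite !convRE.
apply: (le_trans (ler_sum _ (fun i _ => key i))).
rewrite -mulr_sumr ger_pMr ?powR_gt0// big_split/= -!mulr_sumr.
have D (c : 'I_n -> R) C : 0 < C -> (forall i, 0 <= c i) ->
    C `^ r = \sum_i c i `^ r -> \sum_i (c i / C) `^ r = 1.
  move=> C0 c0 NC; have C0' := ltW C0.
  under eq_bigr do rewrite powRM ?invr_ge0//.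
  rewrite -mulr_suml -NC -powRM ?invr_ge0// mulfV ?gt_eqF//.
  by rewrite powR1.
by rewrite !D// !mulr1 addrC subrK.
Qed.

End lp_norm.

Lemma metric_ball_open (R : realFieldType) (T : metricType R) (x : T) (e : R) :
  open (ball x e).
Proof.
rewrite openE => y; rewrite ballEmdist/= => xy.
apply/nbhs_ballP; exists (e - mdist x y); first by rewrite /= subr_gt0.
move=> z; rewrite !ballEmdist/= ltrBrDl; apply: le_lt_trans.
exact: metric_triangle.
Qed.

Section lp_product.
Context {R : realType}.

Definition lp_power (X : Type) (p : \bar R) (p1 : (1 <= p)%E) (n : nat) : Type :=
  n.-tuple X.

Section metric.
Variables (X : completeMetricType R) (p : \bar R) (p1 : (1 <= p)%E) (n : nat).
Local Notation Xn := (lp_power X p1 n).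

HB.instance Definition _ := Choice.copy Xn (n.-tuple X).
HB.instance Definition _ := isPointed.Build Xn [tuple of nseq n point].

Let pdist (x y : Xn) : R :=
  lp_norm p (fun i : 'I_n => mdist (tnth x i) (tnth y i)).

Let pdistxx x : pdist x x = 0.
Proof. by apply: lp_norm0 => // i; rewrite mdistxx. Qed.

Let pdist_positivity x y : pdist x y = 0 -> x = y.
Proof.
move=> xy; apply: eq_from_tnth => i; apply: (@mdist_positivity R).
apply/eqP; rewrite eq_le mdist_ge0 andbT -xy.
by apply: (lp_norm_coord p1 (a := fun i => mdist (tnth x i) (tnth y i))) => ?;
  exact: mdist_ge0.
Qed.

Let pdist_sym x y : pdist x y = pdist y x.
Proof. by rewrite /pdist; congr lp_norm; apply/funext => i; rewrite metric_sym. Qed.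

Let pdist_triangle y x z : pdist x z <= pdist x y + pdist y z.
Proof.
apply: le_trans (lp_normD p1 _ _) => [|i|i]; try exact: mdist_ge0.
by apply: le_lp_norm => // i; [exact: mdist_ge0|exact: metric_triangle].
Qed.

HB.instance Definition _ := isMetric.Build R Xn
  pdistxx pdist_positivity pdist_sym pdist_triangle.

Lemma lp_mdistE (x y : Xn) :
  mdist x y = lp_norm p (fun i : 'I_n => mdist (tnth x i) (tnth y i)).
Proof. by []. Qed.

Lemma lp_mdist_coord (x y : Xn) i : mdist (tnth x i) (tnth y i) <= mdist x y.
Proof.
by apply: (lp_norm_coord p1 (a := fun i => mdist (tnth x i) (tnth y i))) => ?;
  exact: mdist_ge0.
Qed.

Lemma lp_mdist_lt (x y : Xn) (e : R) : 0 < e ->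
  (forall i, mdist (tnth x i) (tnth y i) < e / n.+1%:R) -> mdist x y < e.
Proof.
move=> e0 xy; have := lp_norm_le_sum p1
  (a := fun i : 'I_n => mdist (tnth x i) (tnth y i)) (fun=> mdist_ge0 _ _).
rewrite -lp_mdistE => /le_lt_trans; apply.
apply: (@le_lt_trans _ _ (\sum_(i < n) e / n.+1%:R)).
  by apply: ler_sum => i _; rewrite ltW.
rewrite sumr_const card_ord -[ltLHS]mulr_natr mulrAC ltr_pdivrMr//.
by rewrite ltr_pM2l// ltr_nat.
Qed.

Let lp_complete (F : set_system Xn) : ProperFilter F -> cauchy F -> cvg F.
Proof.
move=> FF /cauchy_ballP cF.
have Fi i : cvg ((@tnth n X ^~ i) @ F).
  apply/cauchy_cvgP/cauchy_ballP => e /cF [[A B] /= [FA FB] AB].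
  exists ((@tnth n X ^~ i) @` A, (@tnth n X ^~ i) @` B) => /=.
    by split; [apply: filterS FA|apply: filterS FB] => x Ax; exists x.
  move=> [_ _] /= [[x Ax <-] [y By <-]].
  have /= := AB (x, y) (conj Ax By).
  by rewrite !ballEmdist/=; exact/le_lt_trans/lp_mdist_coord.
apply/cvg_ex; exists [tuple lim ((@tnth n X ^~ i) @ F) | i < n].
apply/fcvgrPdist_lt => e e0.
have : F [set x | forall i : 'I_n,
    mdist (lim ((@tnth n X ^~ i) @ F)) (tnth x i) < e / n.+1%:R].
  apply: filter_forall => i.
  by move: (Fi i) => /fcvgrPdist_lt; apply; rewrite divr_gt0.
apply: filterS => x Hx; apply: lp_mdist_lt => // i.
by rewrite tnth_mktuple; exact: Hx.
Qed.

HB.instance Definition _ := Uniform_isComplete.Build Xn lp_complete.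

Section separable.
Hypothesis sepX : exists2 D : set X, countable D & dense D.

Let dense_seq : exists s : nat -> X,
  forall x e, 0 < e -> exists k, mdist (s k) x < e.
Proof.
have [D /countable_injP[g ginj] dD] := sepX.
exists (fun k => xget point [set x | D x /\ g x = k]) => x e e0.
have [y [xy Dy]] : (ball x e)° `&` D !=set0.
  apply: dD; last exact: open_interior.
  by exists x; exact: nbhsx_ballx.
exists (g y); case: xgetP => [z _ [Dz gzy]|/(_ y)]; last by case.
have -> : z = y by apply: ginj; rewrite ?inE.
by have := interior_subset xy; rewrite ballEmdist /= metric_sym.
Qed.

Lemma lp_separable : exists2 D : set Xn, countable D & dense D.
Proof.
have [s sP] := dense_seq.
exists ((fun k : n.-tuple nat => [tuple of map s k] : Xn) @` setT).
  exact/(sub_countable (card_image_le _ _))/countableP.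
move=> O [x Ox] oO.
have [e /= e0 xeO] : nbhs_ball x O by rewrite nbhs_ballE; exact: open_nbhs_nbhs.
have en0 : 0 < e / n.+1%:R by rewrite divr_gt0.
pose k : n.-tuple nat := [tuple projT1 (cid (sP (tnth x i) _ en0)) | i < n].
exists ([tuple of map s k] : Xn); split; last by exists k.
apply: xeO; rewrite ballEmdist/=; apply: lp_mdist_lt => // i.
by rewrite metric_sym tnth_map tnth_mktuple; case: cid.
Qed.

Lemma lp_borel_measurable (U : set Xn) : <<s open>> U ->
  measurable (U : set (n.-tuple (borelType X))).
Proof.
have [s sP] := dense_seq.
apply: smallest_sub; first exact: sigma_algebra_measurable.
move=> {}U oU.
pose box (km : n.-tuple nat * nat) : set (n.-tuple (borelType X)) :=
  [set x | forall i, mdist (s (tnth km.1 i)) (tnth x i : X) < km.2.+1%:R^-1].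
have mbox km : measurable (box km).
  rewrite (_ : box km = \bigcap_(i in [set: 'I_n])
      ((@tnth n (borelType X) ^~ i) @^-1`
       (ball (s (tnth km.1 i)) (km.2.+1%:R^-1 : R)))).
    apply: fin_bigcap_measurable => // i _.
    rewrite -[X in measurable X]setTI; apply: measurable_tnth => //.
    by apply: sub_sigma_algebra; exact: metric_ball_open.
  apply/seteqP; split=> x /=; rewrite /box/= => xkm i.
    by move=> _; rewrite /= ballEmdist; exact: xkm.
  by have := xkm i I; rewrite /= ballEmdist.
have -> : (U : set (n.-tuple (borelType X))) =
    \bigcup_km (if `[< box km `<=` U >] then box km else set0).
  apply/seteqP; split=> [x Ux|x [km _]]; last first.
    by case: asboolP => // kmU; exact: kmU.
  have [e /= e0 xeU] : nbhs_ball (x : Xn) U.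
    by rewrite nbhs_ballE; exact: open_nbhs_nbhs.
  have e20 : 0 < e / n.+1%:R / 2 by rewrite !divr_gt0.
  pose m := Num.Def.trunc (e / n.+1%:R / 2)^-1.
  have me : m.+1%:R^-1 < e / n.+1%:R / 2.
    by rewrite -[ltRHS]invrK ltf_pV2 ?posrE ?invr_gt0// truncnS_gt.
  have m0 : (0 : R) < m.+1%:R^-1 by rewrite invr_gt0.
  pose k : n.-tuple nat := [tuple projT1 (cid (sP (tnth x i) _ m0)) | i < n].
  have xk i : mdist (s (tnth k i)) (tnth x i) < m.+1%:R^-1.
    by rewrite tnth_mktuple; case: cid.
  exists (k, m) => //; case: asboolP => // -[] y yk; apply: xeU.
  rewrite ballEmdist /=; apply: lp_mdist_lt => // i.
  rewrite (le_lt_trans (metric_triangle _ (s (tnth k i)) _))// metric_sym.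
  by rewrite [ltRHS]splitr ltrD// (lt_trans _ me)//; exact: yk.
apply: countable_bigcupT_measurable; first exact: countableP.
by move=> km; case: ifP.
Qed.

End separable.
End metric.

Section measure.
Variables (p : \bar R) (p1 : (1 <= p)%E) (n : nat) (X : mmSpace R).

Definition to_lp (x : n.-tuple (borelType X)) : borelType (lp_power X p1 n) := x.

Lemma measurable_to_lp : measurable_fun setT to_lp.
Proof.
by move=> _ U mU; rewrite setTI; apply: lp_borel_measurable mU;
  exact: mm_separable.
Qed.

HB.instance Definition _ :=
  isMeasurableFun.Build _ _ _ _ to_lp measurable_to_lp.

(* The law of the identity map from X^n, with its product sigma-algebra, to X^n
   with the Borel sigma-algebra of the l_p metric. The two sigma-algebras
   coincide since X is separable, so this is the product measure itself. *)
Definition lp_mm : mmSpace R :=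
  MMSpace (lp_separable p1 n (mm_separable X))
    (distribution (power_prob (mm_prob X) n) to_lp).

End measure.
End lp_product.

(* n^{1/(2p)}, read as 1 for p = +oo *)
Definition critical_rate (R : realType) (p : \bar R) (n : nat) : R :=
  if p is r%:E then n%:R `^ (2 * r)^-1 else 1.

(* Main.v *)
Require Import Defs.
From mathcomp Require Import all_boot all_order all_algebra.
From mathcomp Require Import all_classical all_reals all_analysis.
From mathcomp Require Import measurable_realfun ring lra.
Set Implicit Arguments.
Unset Strict Implicit.
Unset Printing Implicit Defensive.
Import Order.TTheory GRing.Theory Num.Theory.
Import numFieldNormedType.Exports.
Local Open Scope classical_set_scope.
Local Open Scope ring_scope.

(** Every l_p metric satisfies d_p <= diam(X) Ham^(1/p), where Ham is the Hamming
    distance. By the Efron-Stein inequality, the Hamming distance to a set of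
    measure at least kappa is O(sqrt n) outside a set of measure kappa, so a
    1-Lipschitz function for t_n d_p is concentrated at scale t_n n^(1/(2p)).

    Conversely, the sums S of phi(x_i), with phi = d(a, .) not almost surely
    constant, satisfy a Littlewood-Offord bound: an interval of length c sqrt n
    has S-mass at most eta if c is small. Hence disjoint intervals of masses
    kappa_0, ..., kappa_N can be placed at mutual distance c sqrt n, and their
    preimages are far apart since |S x - S y| is bounded by the sum of the
    d(x_i, y_i), which is d_p itself for p = 1 and is controlled by d_p^p when X
    is uniformly discrete. For p = +oo a fixed number of coordinates suffices. *)

(** * Elementary inequalities between real-valued probabilities *)

Lemma fine_probD d (T : measurableType d) (R : realType) (P : probability T R)
    (A B C : set T) : measurable A -> measurable B -> measurable C ->
  A `&` B = set0 -> A `|` B `<=` C -> fine (P A) + fine (P B) <= fine (P C).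
Proof.
move=> mA mB mC AB ABC; rewrite -fineD ?fin_num_measure// -measureU//.
apply: fine_le; rewrite ?fin_num_measure//; first exact: measurableU.
by apply: le_measure; rewrite ?inE//; exact: measurableU.
Qed.

Lemma le_fine_prob d (T : measurableType d) (R : realType) (P : probability T R)
    (A B : set T) : measurable A -> measurable B -> A `<=` B ->
  fine (P A) <= fine (P B).
Proof.
move=> mA mB AB; apply: fine_le; rewrite ?fin_num_measure//.
by apply: le_measure; rewrite ?inE.
Qed.

Lemma fine_prob_ge0 d (T : measurableType d) (R : realType)
  (P : probability T R) (A : set T) : 0 <= fine (P A).
Proof. exact: fine_ge0. Qed.

Lemma fine_prob_le1 d (T : measurableType d) (R : realType)
  (P : probability T R) (A : set T) : measurable A -> fine (P A) <= 1.
Proof.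
by move=> mA; rewrite -lee_fin fineK ?fin_num_measure//; exact: probability_le1.
Qed.

Lemma fine_probC d (T : measurableType d) (R : realType)
    (P : probability T R) (A : set T) : measurable A ->
  fine (P (~` A)) = 1 - fine (P A).
Proof.
move=> mA; rewrite probability_setC//.
by rewrite fineB ?fin_num_measure.
Qed.

(** * An integral bound exploiting two disjoint sets of positive mass *)

Section two_level.
Context d (T : measurableType d) (R : realType) (P : probability T R).

(* The integrand is at most M off A and B, and its suprema a over A and b over B
   satisfy a + b <= Z; this costs (M - a) P A + (M - b) P B. *)
Lemma two_level_integral (G : T -> R) (A B : set T) (M Z q : R) :
  measurable_fun setT G -> (forall x, 0 <= G x <= M) ->
  measurable A -> measurable B -> A `&` B = set0 ->
  0 < q -> q <= fine (P A) -> q <= fine (P B) ->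
  (forall x y, A x -> B y -> G x + G y <= Z) ->
  (\int[P]_x (G x)%:E <= (M - q * (2 * M - Z))%:E)%E.
Proof.
move=> mG GM mA mB AB q0 qA qB GZ.
have [x0 Ax0] : A !=set0.
  by apply/set0P/eqP => A0; move: (lt_le_trans q0 qA); rewrite A0 measure0 ltxx.
(* [b] stands in for the supremum over [B]: capping [Z - a] at [M] gives an upper bound of [G] on
   [B] with both [b <= M] and [a + b <= Z]. *)
pose a := sup [set G x | x in A]; pose b := Num.min M (Z - a).
have GA : has_sup [set G x | x in A].
  split; first by exists (G x0), x0.
  by exists M => _ [x _ <-]; case/andP: (GM x).
have aM : a <= M by apply: ge_sup => [|_ [x _ <-]]; [exact: GA.1|case/andP: (GM x)].
have Ga x : A x -> G x <= a by move=> Ax; apply: ub_le_sup; [exact: GA.2|exists x].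
have Gb x : B x -> G x <= b.
  move=> Bx; rewrite /b le_min; case/andP: (GM x) => _ -> /=.
  rewrite lerBrDl addrC -lerBrDl; apply: ge_sup; first exact: GA.1.
  by move=> _ [y Ay <-]; rewrite lerBrDl addrC GZ.
have bM : b <= M by rewrite ge_min lexx.
have abZ : a + b <= Z by rewrite -lerBrDl ge_min lexx orbT.
have Ma : 0 <= M - a by rewrite subr_ge0.
have Mb : 0 <= M - b by rewrite subr_ge0.
(* As [A] and [B] are disjoint, [G] can be raised by [M - a] on [A] and by [M - b] on [B] without
   exceeding [M]. *)
pose H x := G x + ((M - a) * \1_A x + (M - b) * \1_B x).
have HM x : H x <= M.
  rewrite /H !indicE; have [xA|xA] := boolP (x \in A).
    have -> : x \in B = false.
      apply/negbTE/negP => xB; have : (A `&` B) x by split; exact: set_mem.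
      by rewrite AB.
    by have := Ga _ (set_mem xA); rewrite mulr1 mulr0; lra.
  have [xB|xB] := boolP (x \in B); last first.
    by rewrite !mulr0 !addr0; case/andP: (GM x).
  by have := Gb _ (set_mem xB); rewrite mulr1 mulr0; lra.
have mI (C : set T) (c : R) : measurable C -> measurable_fun setT (fun x => c * \1_C x).
  move=> mC; exact: (measurable_funM (measurable_cst c) (measurable_indic mC)).
have I (C : set T) (c : R) : 0 <= c -> measurable C ->
    (\int[P]_x (c * \1_C x)%:E = (c * fine (P C))%:E)%E.
  move=> c0 mC; under eq_integral do rewrite EFinM.
  rewrite ge0_integralZl_EFin//; last exact/measurable_EFinP/measurable_indic.
  by rewrite integral_indic// setIT EFinM fineK ?fin_num_measure.
have le1 : (\int[P]_x (H x)%:E <= M%:E)%E.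
  rewrite -[leRHS]mule1 -(probability_setT P) -integral_cst//.
  apply: ge0_le_integral => //.
  - move=> x _; rewrite lee_fin addr_ge0//; first by case/andP: (GM x).
    by rewrite addr_ge0// mulr_ge0.
  - by apply/measurable_EFinP/measurable_funD => //; apply: measurable_funD; exact: mI.
  - by move=> x _; rewrite lee_fin.
have : (\int[P]_x (G x)%:E + ((M - a) * fine (P A))%:E +
    ((M - b) * fine (P B))%:E <= M%:E)%E.
  apply: le_trans le1; rewrite -!I// -addeA -!ge0_integralD//.
  - by move=> x _; rewrite lee_fin; case/andP: (GM x).
  - exact/measurable_EFinP.
  - by move=> x _; rewrite -EFinD lee_fin addr_ge0 ?mulr_ge0.
  - by apply/measurable_EFinP/measurable_funD; exact: mI.
  - by move=> x _; rewrite lee_fin mulr_ge0.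
  - exact/measurable_EFinP/mI.
  - by move=> x _; rewrite lee_fin mulr_ge0.
  - exact/measurable_EFinP/mI.
have : (0 <= \int[P]_x (G x)%:E)%E.
  by apply: integral_ge0 => x _; rewrite lee_fin; case/andP: (GM x).
case: (integral _ _ _) => [g| |]//=.
move=> g0; rewrite -!EFinD !lee_fin.
have := ler_wpM2l Ma qA; have := ler_wpM2l Mb qB; nra.
Qed.

End two_level.

(** * Concentration of partial sums of independent variables *)

Section partial_sums.
Context d (T : measurableType d) (R : realType) (P : probability T R).
Variables (phi : T -> R) (mphi : measurable_fun setT phi).

(** [m] is kept apart from the length [n], so that a fixed block of coordinates can be used while
    [n] grows, without truncating tuples. *)
Definition psum m n (x : n.-tuple T) : R :=
  \sum_(i < n) if (i < m)%N then phi (tnth x i) else 0.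

Lemma measurable_psum m n : measurable_fun setT (@psum m n).
Proof.
apply: measurable_sum => i; case: (i < m)%N; last exact: measurable_cst.
by apply: (measurableT_comp mphi); exact: measurable_tnth.
Qed.

Lemma psum_cons m n x (y : n.-tuple T) :
  psum m.+1 (tuple_cons (x, y)) = phi x + psum m y.
Proof.
by rewrite /psum big_ord_recl/=; congr (_ + _); apply: eq_bigr => i _; rewrite tnthS.
Qed.

Lemma psum_ge0 m n (x : n.-tuple T) : (forall y, 0 <= phi y) -> 0 <= psum m x.
Proof. by move=> phi0; apply: sumr_ge0 => i _; case: ifP. Qed.

Lemma psum_le m n (x : n.-tuple T) D :
  (forall y, phi y <= D) -> 0 <= D -> psum m x <= n%:R * D.
Proof.
move=> phiD D0; rewrite mulr_natl -[n in leRHS]card_ord -sumr_const.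
by apply: ler_sum => i _; case: ifP.
Qed.

(** Conditioning on the first coordinate: the product measure is by definition the integral of the
    measures of sections. *)
Lemma power_prob_psum m n (B : set R) : measurable B ->
  power_prob P n.+1 (@psum m.+1 n.+1 @^-1` B) =
  (\int[P]_x power_prob P n (@psum m n @^-1` [set r | B (phi x + r)%R]))%E.
Proof.
move=> mB; rewrite /= /distribution /pushforward /product_measure1.
apply: eq_integral => x _; congr (power_prob P n _).
by apply/seteqP; split => y; rewrite /xsection/= inE/= psum_cons.
Qed.

Variable D : R.

(** The windows are half-open: those whose left ends are at least [D] apart are disjoint, and
    adjacent ones tile an interval. *)
Definition conc m n (a : R) : R :=
  fine (power_prob P n (@psum m n @^-1` `[a, a + D[)).

Lemma measurable_psum_preimage m n (B : set R) :
  measurable B -> measurable (@psum m n @^-1` B).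
Proof. by move=> mB; rewrite -[X in measurable X]setTI; exact: measurable_psum. Qed.

Lemma concE m n a :
  (conc m n a)%:E = power_prob P n (@psum m n @^-1` `[a, a + D[).
Proof. by rewrite fineK// fin_num_measure//; exact: measurable_psum_preimage. Qed.

Let shift_itv m n a x : @psum m n @^-1` `[a - phi x, a - phi x + D[ =
  @psum m n @^-1` [set r | [set` `[a, a + D[] (phi x + r)].
Proof.
apply/seteqP; split => y /=; rewrite !in_itv/= => /andP[? ?]; apply/andP; split; lra.
Qed.

(** As a function of [x], this is the measure of the section at [x] of a measurable subset of the
    product. *)
Lemma measurable_conc m n a : measurable_fun setT (fun x => conc m n (a - phi x)).
Proof.
apply/measurable_EFinP.
rewrite (_ : _ \o _ = power_prob P n \o
  xsection [set xy : T * n.-tuple T | [set` `[a, a + D[] (phi xy.1 + psum m xy.2)]).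
  apply: measurable_fun_xsection.
  rewrite -[X in measurable X]setTI.
  apply: (@measurable_funD _ _ _ setT (phi \o fst) (@psum m n \o snd)) => //.
    exact: measurableT_comp.
  by apply: measurableT_comp => //; exact: measurable_psum.
apply/funext => x /=; rewrite concE shift_itv; congr (power_prob P n _).
by apply/seteqP; split => y; rewrite /xsection/= inE.
Qed.

Lemma conc_rec m n a :
  (conc m.+1 n.+1 a)%:E = (\int[P]_x (conc m n (a - phi x)%R)%:E)%E.
Proof.
rewrite concE power_prob_psum//.
by apply: eq_integral => x _; rewrite concE shift_itv.
Qed.

Lemma conc_ge0 m n a : 0 <= conc m n a.
Proof. exact: fine_prob_ge0. Qed.

Hypothesis D0 : 0 < D.
Local Notation gap := (fun a b => a + D <= b).

(** The windows are pairwise disjoint. The half-line carries the induction: the windows of the tail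
    all lie to the right of the first one. *)
Lemma conc_path m n a s : path gap a s ->
  \sum_(b <- a :: s) conc m n b <=
  fine (power_prob P n (@psum m n @^-1` `[a, +oo[)).
Proof.
elim: s a => [|b s IH] a /=.
  rewrite big_seq1 => _; apply: le_fine_prob;
    try exact: measurable_psum_preimage.
  by move=> x /=; rewrite !in_itv/= => /andP[->].
move=> /andP[ab] /IH bs; rewrite big_cons.
apply: le_trans (lerD (lexx _) bs) _.
apply: fine_probD; try exact: measurable_psum_preimage.
  apply/seteqP; split => // x /= []; rewrite !in_itv/= andbT => /andP[_ xa] bx.
  by have := lt_le_trans (lt_le_trans xa ab) bx; rewrite ltxx.
move=> x /= []; rewrite !in_itv/= !andbT; first by case/andP.
by apply: le_trans; apply: le_trans ab; rewrite lerDl ltW.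
Qed.

Lemma conc_sum_le1 m n s : sorted gap s -> \sum_(b <- s) conc m n b <= 1.
Proof.
case: s => [|a s]; first by rewrite big_nil.
move=> /(@conc_path m n)/le_trans; apply; apply: fine_prob_le1.
exact: measurable_psum_preimage.
Qed.

Variables (q al : R).
Hypotheses (q0 : 0 < q) (qlo : q <= fine (P (phi @^-1` `]-oo, al])))
  (qhi : q <= fine (P (phi @^-1` `[al + D, +oo[))).

(* [k (L - k) / (2 q)] is the expected exit time from (0, L) of the walk started
   at k that moves by +1 and by -1 with probability q each. *)
Lemma conc_sum_le L m n s : (0 < L)%N -> (m <= n)%N -> sorted gap s ->
  (size s <= L)%N ->
  m%:R * \sum_(a <- s) conc m n a <=
  m%:R * ((size s)%:R / L%:R) + (size s)%:R * (L%:R - (size s)%:R) / (2 * q).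
Proof.
move=> L0.
have LR0 : (0 : R) < L%:R by rewrite ltr0n.
elim: m n s => [|m IH] n s mn ss sL.
  rewrite !mul0r add0r divr_ge0// ?mulr_ge0 ?subr_ge0 ?ler_nat//.
  exact: ltW.
case: n mn => // n mn.
have c1 := conc_sum_le1 m.+1 n.+1 ss.
case: s ss sL c1 => [|a r] ss sL c1.
  by rewrite big_nil !mulr0 !mul0r addr0.
(* A family of full size [L] leaves no room for one more window; there the bound is [m.+1%:R], which
   disjointness alone gives. *)
move: sL; rewrite leq_eqVlt => /orP[/eqP ->|sL].
  rewrite subrr mulr0 mul0r addr0 divff ?gt_eqF// mulr1.
  by rewrite -[leRHS]mulr1 ler_wpM2l.
set k : R := (size (a :: r))%:R.
pose v (j : R) : R := j * (L%:R - j) / (2 * q).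
pose M : R := m%:R * (k / L%:R) + v k.
pose Z : R := m%:R * ((k + 1) / L%:R) + v (k + 1) + (m%:R * ((k - 1) / L%:R) + v (k - 1)).
pose G x : R := m%:R * \sum_(b <- a :: r) conc m n (b - phi x).
have shift_sorted x s : sorted gap s -> sorted gap [seq b - phi x | b <- s].
  apply: homo_sorted => b c; rewrite addrAC; lra.
(* [v] has second difference [- 1 / q], so the gain [q * (2 * M - Z)] is exactly 1. It pays for the
   passage from [m] to [m.+1], since the windows have total mass at most 1. *)
have MZ : M - q * (2 * M - Z) = M - 1.
  rewrite /M /Z /v; field.
  by rewrite !gt_eqF.
have IG : (\int[P]_x (G x)%:E)%E = (m%:R * \sum_(b <- a :: r) conc m.+1 n.+1 b)%:E.
  rewrite /G; under eq_integral do rewrite EFinM.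
  rewrite ge0_integralZl_EFin//; first last.
  - by apply/measurable_EFinP/measurable_sum => b; exact: measurable_conc.
  - by move=> y _; rewrite lee_fin sumr_ge0// => *; exact: conc_ge0.
  rewrite EFinM; congr (_ * _)%E.
  under eq_integral do rewrite -sumEFin.
  rewrite ge0_integral_sum//; first last.
  - by move=> b x _; rewrite lee_fin; exact: conc_ge0.
  - by move=> b; apply/measurable_EFinP; exact: measurable_conc.
  by rewrite -sumEFin; apply: eq_bigr => b _; rewrite conc_rec.
have le : (\int[P]_x (G x)%:E <= (M - q * (2 * M - Z))%:E)%E.
  apply: (@two_level_integral _ _ _ _ G (phi @^-1` `]-oo, al])
    (phi @^-1` `[al + D, +oo[)) => //.
  - apply: (measurable_funM (measurable_cst _)); apply: measurable_sum => b.
    exact: measurable_conc.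
  - move=> x; rewrite mulr_ge0 ?sumr_ge0//=; last by move=> *; exact: conc_ge0.
    have := IH n [seq b - phi x | b <- a :: r] mn (shift_sorted x _ ss).
    by rewrite size_map big_map => /(_ (ltnW sL)).
  - by rewrite -[X in measurable X]setTI; exact: mphi.
  - by rewrite -[X in measurable X]setTI; exact: mphi.
  - apply/seteqP; split => // x /=; rewrite !in_itv/= andbT => -[xa ax].
    by have := le_trans ax xa; rewrite gerDl leNgt D0.
  - (* regrouping: the head shifted by the larger [phi y] extends one family *)
    move=> x y /=; rewrite !in_itv/= andbT => xa ay.
    have := IH n ((a - phi y) :: [seq b - phi x | b <- a :: r]) mn.
    rewrite /= size_map !big_cons big_map.
    have -> : a - phi y + D <= a - phi x by lra.
    move=> /(_ (shift_sorted x _ ss) sL).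
    have := IH n [seq b - phi y | b <- r] mn.
    rewrite size_map big_map => /(_ (shift_sorted y _ (path_sorted ss))).
    move=> /(_ (ltnW (ltnW sL))).
    rewrite /G /Z /v /k/= !big_cons.
    have -> : (size r).+2%:R = (size r)%:R + 2 :> R by rewrite -addn2 natrD.
    have -> : (size r).+1%:R = (size r)%:R + 1 :> R by rewrite -addn1 natrD.
    rewrite !addrK; move: (size r)%:R => j h1 h2; lra.
rewrite IG lee_fin MZ in le.
have -> : m.+1%:R = m%:R + 1 :> R by rewrite -natr1.
have : 0 <= k / L%:R by rewrite divr_ge0.
rewrite /M /v -/k in le *; lra.
Qed.

End partial_sums.

(** * Separated blocks of prescribed masses *)

(** Discrete quantiles: at the first index where [W] reaches a level, it exceeds that level by less
    than [eta]. Each block spends one [eta] on the overshoot at its left end and one on strict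
    separation from the next block. *)
Lemma quantile_blocks (R : realFieldType) (W : nat -> R) (eta : R) (J N : nat)
    (kappa : 'I_N.+1 -> R) : 0 < eta -> W 0%N = 0 -> 1 <= W J ->
  (forall j, W j.+1 <= W j + eta) -> (forall i, 0 <= kappa i) ->
  \sum_i kappa i + 2 * N.+1%:R * eta <= 1 ->
  exists l r : 'I_N.+1 -> nat, (forall i, kappa i <= W (r i) - W (l i)) /\
    (forall i j : 'I_N.+1, (i < j)%N -> (r i < l j)%N).
Proof.
move=> eta0 W0 WJ Weta kappa0 sum_kappa.
(* Capping at 1 makes the quantile [tau c] exist for every real [c]. *)
have ex c : exists j, W j >= Num.min c 1.
  by exists J; rewrite ge_min WJ orbT.
pose tau c := ex_minn (ex c).
have tau_ge c : c <= 1 -> c <= W (tau c).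
  by rewrite /tau => c1; case: ex_minnP => j + _; rewrite min_l.
have tau_lt c : 0 <= c -> c <= 1 -> W (tau c) < c + eta.
  move=> c0 c1; rewrite /tau; case: ex_minnP; rewrite min_l// => -[|j] _ jmin.
    by rewrite W0 ltr_wpDl.
  apply: le_lt_trans (Weta j) _; rewrite ltrD2r ltNge; apply/negP => /jmin.
  by rewrite ltnn.
have tau_le c e : c <= e -> e <= 1 -> (tau c <= tau e)%N.
  move=> ce e1; rewrite {1}/tau; case: ex_minnP => j _; apply.
  by rewrite min_l; [apply: (le_trans ce); exact: tau_ge|exact: le_trans e1].
(* The level at which block [i] starts: [kappa j + 2 * eta] is reserved for each [j < i]. *)
pose C (i : nat) := \sum_(j < N.+1 | (j < i)%N) kappa j + 2 * i%:R * eta.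
have C0 i : 0 <= C i.
  by rewrite addr_ge0 ?sumr_ge0// !mulr_ge0// ltW.
have CS (i : 'I_N.+1) (j : nat) : (i < j)%N -> C i + kappa i + 2 * eta <= C j.
  move=> ij; rewrite /C [in leRHS](bigD1 i)//=.
  have : \sum_(j < N.+1 | (j < i)%N) kappa j <=
      \sum_(i0 < N.+1 | (i0 < j)%N && (i0 != i)) kappa i0.
    rewrite [leRHS](bigID (fun k : 'I_N.+1 => (k < i)%N))/= -[leLHS]addr0 lerD//.
      rewrite le_eqVlt; apply/orP; left; apply/eqP; apply: eq_bigl => k.
      have [ki|] := ltnP k i; rewrite ?andbF//.
      by rewrite (ltn_trans ki ij) neq_ltn ki.
    exact: sumr_ge0.
  have : (i%:R + 1) * eta <= j%:R * eta :> R.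
    by rewrite ler_wpM2r ?(ltW eta0)// natr1 ler_nat.
  lra.
have C1 (i : 'I_N.+1) : C i + kappa i + eta <= 1.
  apply: (@le_trans _ _ (C N.+1)).
    by apply: le_trans (CS i _ (ltn_ord i)); lra.
  apply: le_trans sum_kappa; rewrite lerD2r le_eqVlt; apply/orP; left.
  by apply/eqP; apply: eq_bigl => k; rewrite ltn_ord.
exists (fun i : 'I_N.+1 => tau (C i)), (fun i : 'I_N.+1 => tau (C i + kappa i + eta)); split=> [i|i j ij].
  have := C0 i; have := C1 i; have := kappa0 i => k0 c1 c0.
  have := tau_ge _ c1.
  have : C i <= 1 by lra.
  by move=> /(tau_lt _ c0); lra.
have Cij := CS i j ij; have k0 := kappa0 i; have kj := kappa0 j.
have ci := C1 i; have cj := C1 j; have c0 := C0 i.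
have le1 : C j <= 1 by lra.
(* Monotonicity of [tau] gives [<=]; at a common index [W] would be both at least [C j] and less
   than [C i + kappa i + 2 * eta <= C j]. *)
rewrite ltn_neqAle tau_le ?andbT//; last lra.
apply/eqP => e; have := tau_ge _ le1; rewrite -e.
have : 0 <= C i + kappa i + eta by lra.
by move=> /tau_lt/(_ ci); lra.
Qed.

(** * Small-ball bound and separated intervals for the partial sums *)

Section spread.
Context d (T : measurableType d) (R : realType) (P : probability T R).
Variables (phi : T -> R) (mphi : measurable_fun setT phi).
Variables (D q al : R).
Hypotheses (D0 : 0 < D) (q0 : 0 < q)
  (qlo : q <= fine (P (phi @^-1` `]-oo, al])))
  (qhi : q <= fine (P (phi @^-1` `[al + D, +oo[))).

Let mpre m n (B : set R) : measurable B -> measurable (psum phi m (n := n) @^-1` B).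
Proof. exact: measurable_psum_preimage. Qed.

Lemma psum_itv_le_conc m n k a :
  fine (power_prob P n (psum phi m (n := n) @^-1` `[a, a + k%:R * D[)) <=
  \sum_(b <- [seq a + j%:R * D | j <- iota 0 k]) conc P phi D m n b.
Proof.
elim: k => [|k IH].
  rewrite big_nil mul0r addr0 (_ : _ @^-1` _ = set0) ?measure0//.
  by apply/seteqP; split => // x /=; rewrite in_itv/= => /andP[/le_lt_trans/[apply]]; rewrite ltxx.
rewrite -addn1 iotaD add0n map_cat big_cat/= big_seq1.
apply: le_trans (lerD IH (lexx _)).
rewrite -fineD ?fin_num_measure//; try exact: mpre.
apply: fine_le; rewrite ?fin_numD ?fin_num_measure//; try exact: mpre.
apply: le_trans (measureU2 _ _ _); try exact: mpre.
apply: le_measure; rewrite ?inE; first exact: mpre.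
  by apply: measurableU; exact: mpre.
move=> x /=; rewrite !in_itv/= => /andP[ax xk].
case: (ltP (psum phi m x) (a + k%:R * D)) => h; [left|right].
  by rewrite ax.
by move: xk; rewrite natrD mulrDl mul1r addrA.
Qed.

(** Littlewood-Offord: [conc_sum_le] is applied to [k = L %/ J] adjacent windows, where [L] is the
    integer part of [sqrt m]. As [k <= L / J] and [L^2 <= m], their total mass is at most
    [(1 + 1 / (2 q)) / J], and [J] is chosen to bring this below [eta]. *)
Lemma psum_small_ball eta : 0 < eta -> exists c : R, exists N : nat,
  [/\ 0 < c, (0 < N)%N & forall m n a, (N <= m)%N -> (m <= n)%N ->
    fine (power_prob P n (psum phi m (n := n) @^-1` `[a, a + c * Num.sqrt m%:R[)) <= eta].
Proof.
move=> eta0.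
pose J := (Num.truncn ((1 + (2 * q)^-1) / eta)).+1.
have J0 : (0 : R) < J%:R by rewrite ltr0n.
have JE : (1 + (2 * q)^-1) / J%:R <= eta.
  rewrite ler_pdivrMr// [eta * _]mulrC -ler_pdivrMr//; apply: ltW.
  exact: truncnS_gt.
(* The [k] windows cover the interval because [sqrt m < L + 1 <= 2 L <= 2 (k + 1) J <= 4 k J];
   [m >= J^2] ensures [k >= 1]. *)
exists (D / (4 * J%:R)), (J * J)%N; split => [||m n a Jm mn].
- by rewrite divr_gt0// mulr_gt0.
- by [].
have m0 : (0 : R) < m%:R by rewrite ltr0n (leq_trans _ Jm).
have s0 : 0 <= Num.sqrt m%:R :> R by exact: sqrtr_ge0.
have ss : Num.sqrt m%:R ^+ 2 = m%:R :> R by rewrite sqr_sqrtr ?ltW.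
set L := Num.truncn (Num.sqrt m%:R : R).
have /andP[Lle Llt] := truncn_itv s0; rewrite -/L in Lle Llt.
have JL : (J <= L)%N.
  rewrite /L truncn_ge_nat// -[leLHS]ger0_norm ?ler0n// -sqrtr_sqr.
  by rewrite ler_wsqrtr// -natrX ler_nat -mulnn.
have L0 : (0 < L)%N by exact: leq_trans JL.
have LR0 : (0 : R) < L%:R by rewrite ltr0n.
set k := (L %/ J)%N.
have kJ : k%:R * J%:R <= L%:R :> R by rewrite -natrM ler_nat leq_divM.
have k1 : (1 : R) <= k%:R by rewrite ler1n divn_gt0.
have Lk : L%:R <= (k%:R + 1) * J%:R :> R.
  by rewrite natr1 -natrM ler_nat ltnW// ltn_ceil.
have kL : (k <= L)%N by exact: leq_div.
have LS : L.+1%:R <= 2 * L%:R :> R by rewrite -natrM ler_nat mul2n -addnn -addn1 leq_add2l.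
have L2 : L%:R ^+ 2 <= m%:R :> R by rewrite -ss ler_sqr ?nnegrE.
pose s := [seq a + j%:R * D | j <- iota 0 k].
have := psum_itv_le_conc m n k a; rewrite -/s => le1.
have srt : sorted (fun a b => a + D <= b) s.
  apply: homo_sorted (iota_ltn_sorted 0 k) => i j ij.
  rewrite -addrA lerD2l -[X in _ + X]mul1r -mulrDl ler_wpM2r ?(ltW D0)//.
  by rewrite natr1 ler_nat.
have szs : size s = k by rewrite size_map size_iota.
have := @conc_sum_le _ _ _ P _ mphi D D0 q al q0 qlo qhi L m n s L0 mn srt.
rewrite szs => /(_ kL) le2.
have le3 : fine (power_prob P n (psum phi m (n := n) @^-1`
      `[a, a + D / (4 * J%:R) * Num.sqrt m%:R[)) <=
    fine (power_prob P n (psum phi m (n := n) @^-1` `[a, a + k%:R * D[)).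
  apply: le_fine_prob; try exact: mpre.
  move=> x /=; rewrite !in_itv/= => /andP[-> /=] /lt_le_trans; apply.
  rewrite lerD2l mulrAC ler_pdivrMr ?mulr_gt0// mulrC mulrAC ler_pM2r//.
  by apply: ltW (lt_le_trans Llt _); nra.
apply: le_trans le3 (le_trans le1 _); apply: le_trans JE.
rewrite ler_pdivlMr//.
have q20 : 0 < (2 * q)^-1 by rewrite invr_gt0 mulr_gt0.
set S := \sum_(b <- s) _ in le2 *.
have e1 : m%:R * (k%:R / L%:R) * J%:R <= m%:R :> R.
  rewrite -mulrA ger_pMr// mulrAC ler_pdivrMr// mul1r; exact: kJ.
have e2 : k%:R * (L%:R - k%:R) * J%:R <= m%:R :> R.
  apply: le_trans L2; rewrite mulrAC expr2 ler_pM ?subr_ge0 ?ler_nat ?mulr_ge0//.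
  by rewrite gerBl.
rewrite -(ler_pM2l m0) mulrA; apply: le_trans (ler_wpM2r (ltW J0) le2) _.
rewrite mulrDl; apply: (@le_trans _ _ (m%:R + m%:R * (2 * q)^-1)).
  by rewrite lerD// mulrAC ler_wpM2r// ltW.
by rewrite mulrDr mulr1.
Qed.

(** Quantiles of the law of the sum on a grid of step [g = c sqrt m]: the small-ball bound keeps the
    increments of [W] below [eta], and distinct grid points are at distance at least [g]. *)
Lemma psum_spread N (kappa : 'I_N.+1 -> R) (E : R) :
  (forall x, 0 <= phi x <= E) -> (forall i, 0 <= kappa i) ->
  \sum_i kappa i < 1 ->
  exists c : R, exists M : nat,
  [/\ 0 < c, (0 < M)%N & forall m n, (M <= m)%N -> (m <= n)%N ->
    exists u v : 'I_N.+1 -> R,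
    (forall i, kappa i <=
      fine (power_prob P n (psum phi m (n := n) @^-1` `[u i, v i[))) /\
    (forall i j : 'I_N.+1, (i < j)%N -> v i + c * Num.sqrt m%:R <= u j)].
Proof.
move=> phiE kappa0 sum_kappa.
(* With this choice [\sum_i kappa i + 2 * N.+1%:R * eta] equals 1. *)
pose eta := (1 - \sum_i kappa i) / (2 * N.+1%:R).
have eta0 : 0 < eta by rewrite divr_gt0 ?subr_gt0// mulr_gt0.
have [c [M [c0 M0 cM]]] := psum_small_ball eta0.
exists c, M; split => // m n Mm mn.
set g := c * Num.sqrt m%:R.
have g0 : 0 < g by rewrite mulr_gt0// sqrtr_gt0 ltr0n (leq_trans M0).
pose W (j : nat) := fine (power_prob P n (psum phi m (n := n) @^-1` `]-oo, j%:R * g[)).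
have E0 : 0 <= E by case/andP: (phiE point) => /le_trans; exact.
have W0 : W 0%N = 0.
  rewrite /W mul0r (_ : _ @^-1` _ = set0) ?measure0//.
  apply/seteqP; split => // x /=; rewrite in_itv/= ltNge psum_ge0// => y.
  by case/andP: (phiE y).
(* The sum is at most [n%:R * E], so [J] grid steps exhaust its range. *)
pose J := (Num.truncn (n%:R * E / g)).+1.
have WJ : 1 <= W J.
  rewrite /W (_ : _ @^-1` _ = setT) ?probability_setT//.
  apply/seteqP; split => // x _ /=; rewrite in_itv/=.
  apply: (@le_lt_trans _ _ (n%:R * E)).
    by apply: psum_le => // y; case/andP: (phiE y).
  by rewrite -ltr_pdivrMr// truncnS_gt.
have Weta j : W j.+1 <= W j + eta.
  apply: le_trans (lerD (lexx _) (cM m n (j%:R * g) Mm mn)); rewrite -/g.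
  rewrite -fineD ?fin_num_measure//; try exact: mpre.
  apply: fine_le; rewrite ?fin_numD ?fin_num_measure//; try exact: mpre.
  apply: le_trans (measureU2 _ _ _); try exact: mpre.
  apply: le_measure; rewrite ?inE; first exact: mpre.
    by apply: measurableU; exact: mpre.
  move=> x /=; rewrite !in_itv/= -natr1 mulrDl mul1r => h.
  by case: ltP => h'; [left|right].
have sumE : \sum_i kappa i + 2 * N.+1%:R * eta <= 1.
  rewrite /eta [_ * (_ / _)]mulrC divfK; first by rewrite addrC subrK.
  by rewrite mulf_neq0 ?pnatr_eq0.
have [l [r [lr rl]]] := quantile_blocks eta0 W0 WJ Weta kappa0 sumE.
exists (fun i => (l i)%:R * g), (fun i => (r i)%:R * g); split.
  move=> i; apply: le_trans (lr i) _; rewrite lerBlDr addrC.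
  rewrite /W -fineD ?fin_num_measure//; try exact: mpre.
  apply: fine_le; rewrite ?fin_numD ?fin_num_measure//; try exact: mpre.
  apply: le_trans (measureU2 _ _ _); try exact: mpre.
  apply: le_measure; rewrite ?inE; first exact: mpre.
    by apply: measurableU; exact: mpre.
  move=> x /=; rewrite !in_itv/= => h.
  by case: ltP => h'; [left|right].
move=> i j ij; rewrite -/g -[X in _ + X]mul1r -mulrDl.
by rewrite ler_pM2r// natr1 ler_nat rl.
Qed.

End spread.

(** * Bounded integrands and Chebyshev's inequality *)

Section probability_integrals.
Context d (U : measurableType d) (R : realType) (Q : probability U R).

Lemma bounded_integrable (u : U -> R) M :
  measurable_fun setT u -> (forall x, 0 <= u x <= M) ->
  Q.-integrable setT (EFin \o u).
Proof.
move=> mu uM; apply: measurable_bounded_integrable => //.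
  exact: le_lt_trans (probability_le1 Q measurableT) (ltry _).
exists M; split; first exact: num_real.
move=> r Mr x _ /=; case/andP: (uM x) => u0 uMx.
by rewrite ger0_norm// (le_trans uMx)// ltW.
Qed.

Lemma Rintegral_prob_cst c : \int[Q]_x (cst c x) = c.
Proof. by rewrite Rintegral_cst//= probability_setT/= mulr1. Qed.

Lemma integrable_prob_cst (c : R) : Q.-integrable setT (EFin \o cst c).
Proof. exact: finite_measure_integrable_cst. Qed.

(** Chebyshev about an arbitrary centre [c]: the function equal to [s] on [B] and 0 elsewhere is
    below the squared deviation. *)
Lemma second_moment_markov (h : U -> R) (B : set U) c s V :
  measurable_fun setT h -> measurable B -> 0 <= s -> (\int[Q]_x ((h x - c) ^+ 2)%:E <= V%:E)%E ->
  (forall x, B x -> s <= (h x - c) ^+ 2) -> s * fine (Q B) <= V.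
Proof.
move=> mh mB s0 hV sB; rewrite -lee_fin; apply: le_trans hV.
rewrite EFinM fineK ?fin_num_measure// -(setIT B).
rewrite -integral_indic// -ge0_integralZl_EFin//; last first.
  exact/measurable_EFinP/measurable_indic.
apply: ge0_le_integral => //.
- by move=> x _; rewrite -EFinM lee_fin mulr_ge0.
- apply/measurable_EFinP.
  exact: (measurable_funM (measurable_cst s) (measurable_indic mB)).
- by apply/measurable_EFinP/measurable_funX/measurable_funB.
- move=> x _; rewrite -EFinM lee_fin indicE.
  by case: (boolP (x \in B)) => [/set_mem/sB|_]; rewrite ?mulr1// mulr0 sqr_ge0.
Qed.

End probability_integrals.

(** * Concentration for the Hamming distance *)

Section hamming.
Context d (T : measurableType d) (R : realType).

Definition ham n (x y : n.-tuple T) : R := \sum_(i < n) (tnth x i != tnth y i)%:R.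

Lemma ham_ge0 n (x y : n.-tuple T) : 0 <= ham x y.
Proof. exact: sumr_ge0. Qed.

Lemma hamxx n (x : n.-tuple T) : ham x x = 0.
Proof. by apply: big1 => i _; rewrite eqxx. Qed.

Lemma ham_triangle n (y x z : n.-tuple T) : ham x z <= ham x y + ham y z.
Proof.
rewrite -big_split/=; apply: ler_sum => i _; rewrite -natrD ler_nat.
by have [->|_] := eqVneq (tnth x i) (tnth y i); case: (tnth _ _ != tnth z i).
Qed.

Lemma ham_cons n a b (x y : n.-tuple T) :
  ham (tuple_cons (a, x)) (tuple_cons (b, y)) = (a != b)%:R + ham x y.
Proof.
rewrite /ham big_ord_recl/=; congr (_ + _).
by apply: eq_bigr => i _; rewrite !tnthS.
Qed.

Variable P : probability T R.

(** With [m] the mean of [u], oscillation at most 1 gives [(u - m)^2 <= 1], and the cross term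
    [2 (m - c) (u - m)] integrates to zero. *)
Lemma sqr_dev_le (u : T -> R) c : measurable_fun setT u ->
  (forall x, 0 <= u x) -> (forall x y, u x - u y <= 1) ->
  (\int[P]_x ((u x - c) ^+ 2)%:E <= (1 + (\int[P]_x u x - c) ^+ 2)%:E)%E.
Proof.
move=> mu u0 u1; set m := (\int[P]_x u x)%R.
have iu : P.-integrable setT (EFin \o u).
  apply: (@bounded_integrable _ _ _ _ _ (u point + 1)) => // x.
  by rewrite u0/= addrC -lerBlDr.
have um x : `|u x - m| <= 1.
  have lo : u x - 1 <= m.
    rewrite -(Rintegral_prob_cst P (u x - 1)); apply: le_Rintegral => //=.
      exact: integrable_prob_cst.
    by move=> y _; rewrite lerBlDr -lerBlDl.
  have hi : m <= u x + 1.
    rewrite -(Rintegral_prob_cst P (u x + 1)); apply: le_Rintegral => //=.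
      exact: integrable_prob_cst.
    by move=> y _; rewrite -lerBlDl.
  by rewrite ler_distl; apply/andP; split; lra.
(* [f] is [1 + (m - c)^2 + 2 (m - c) (u - m)], rearranged as an affine function of [u]. *)
pose a : R := 1 + (m - c) ^+ 2 - 2 * (m - c) * m.
pose f x := a + 2 * (m - c) * u x.
have iBu : P.-integrable setT (EFin \o (fun x => 2 * (m - c) * u x)).
  exact: (integrableZl measurableT (2 * (m - c)) iu).
have iF : P.-integrable setT (EFin \o f).
  exact: (integrableD _ (integrable_prob_cst P _) iBu).
have sq x : (u x - c) ^+ 2 <= f x.
  have : (u x - m) ^+ 2 <= 1.
    by rewrite -[leRHS](expr1n _ 2) -ler_sqrt// !sqrtr_sqr normr1; exact: um.
  rewrite /f /a; nra.
have intf : \int[P]_x f x = a + 2 * (m - c) * m.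
  rewrite /f RintegralD//; last exact: integrable_prob_cst.
  by rewrite RintegralZl// Rintegral_prob_cst.
have -> : 1 + (m - c) ^+ 2 = \int[P]_x f x by rewrite intf /a; ring.
rewrite /Rintegral fineK; last exact: integrable_fin_num.
apply: ge0_le_integral => //.
- by move=> x _; rewrite lee_fin sqr_ge0.
- by apply/measurable_EFinP/measurable_funX/measurable_funB.
- by apply/measurable_EFinP/measurable_funD => //; exact: measurable_funM.
- by move=> x _; rewrite lee_fin.
Qed.

(* Efron-Stein, by induction on [n]: average over the first coordinate. *)
Lemma hamming_lipschitz_variance n (h : n.-tuple T -> R) :
  measurable_fun setT h -> (forall x, 0 <= h x) ->
  (forall x y, h x - h y <= ham x y) ->
  exists c, (\int[power_prob P n]_x ((h x - c) ^+ 2)%:E <= n%:R%:E)%E.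
Proof.
elim: n h => [|n IH] h mh h0 hham.
  exists (h [tuple]); rewrite [leLHS](_ : _ = 0%E)//.
  by apply: integral0_eq => x _; rewrite (tuple0 x) subrr expr0n.
pose h2 (z : T * n.-tuple T) := h (tuple_cons z).
have mh2 : measurable_fun setT h2.
  by apply: measurableT_comp => //; exact: measurable_tuple_cons.
(* Averaging preserves the Hamming-Lipschitz bound, and the centre that the induction finds for [g]
   will also serve for [h]. *)
pose g y := \int[P]_x h2 (x, y).
have ih y : P.-integrable setT (EFin \o (fun x => h2 (x, y))).
  apply: (@bounded_integrable _ _ _ _ _ (h2 (point, y) + 1)).
    exact: measurable_fun_pair1 mh2.
  move=> x; rewrite h0/= addrC -lerBlDr; apply: le_trans (hham _ _) _.
  by rewrite ham_cons hamxx addr0; case: (_ != _).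
have gE y : (g y)%:E = (\int[P]_x (h2 (x, y))%:E)%E.
  by rewrite /g /Rintegral fineK//; exact: (integrable_fin_num measurableT (ih y)).
have mg : measurable_fun setT g.
  apply/measurable_EFinP; rewrite (_ : _ \o _ = fubini_G P (EFin \o h2)).
    apply: measurable_fun_fubini_tonelli_G; first exact/measurable_EFinP.
    by move=> x; rewrite lee_fin; exact: h0.
  by apply/funext => y /=; rewrite gE.
have g0 y : 0 <= g y by apply: Rintegral_ge0 => x _; exact: h0.
have gham y z : g y - g z <= ham y z.
  rewrite lerBlDl -(Rintegral_prob_cst P (ham y z)) -RintegralD//; last first.
    exact: integrable_prob_cst.
  apply: le_Rintegral => //.
    exact: (integrableD _ (ih z) (integrable_prob_cst P _)).
  move=> x _; rewrite -lerBlDl; apply: le_trans (hham _ _) _.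
  by rewrite ham_cons eqxx add0r.
have [c gc] := IH g mg g0 gham; exists c.
have msq : measurable_fun setT (fun x : n.+1.-tuple T => ((h x - c) ^+ 2)%:E).
  by apply/measurable_EFinP/measurable_funX/measurable_funB.
rewrite [power_prob P n.+1]/= ge0_integral_distribution//; last first.
  by move=> x; rewrite lee_fin sqr_ge0.
rewrite fubini_tonelli2//; first last.
- by move=> x /=; rewrite lee_fin sqr_ge0.
- apply: (measurableT_comp msq); exact: measurable_tuple_cons.
(* For fixed [y], the section of [h] has oscillation at most 1 and mean [g y]; the new coordinate
   thus adds at most 1. *)
apply: (@le_trans _ _ (\int[power_prob P n]_y (1%:E + ((g y - c) ^+ 2)%:E))%E).
  apply: ge0_le_integral => //.
  - by move=> y _; apply: integral_ge0 => x _; rewrite lee_fin sqr_ge0.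
  - apply: measurable_fun_fubini_tonelli_G.
      apply: (measurableT_comp msq); exact: measurable_tuple_cons.
    by move=> x /=; rewrite lee_fin sqr_ge0.
  - apply: emeasurable_funD => //.
    by apply/measurable_EFinP/measurable_funX/measurable_funB.
  - move=> y _; apply: (sqr_dev_le (u := fun x => h2 (x, y))).
    + exact: measurable_fun_pair1 mh2.
    + by move=> x; exact: h0.
    + move=> x z; apply: le_trans (hham _ _) _.
      by rewrite ham_cons hamxx addr0; case: (_ != _).
rewrite ge0_integralD//; first last.
- by apply/measurable_EFinP/measurable_funX/measurable_funB.
- by move=> y _; rewrite lee_fin sqr_ge0.
rewrite integral_cst// mul1e -natr1 addrC EFinD leeD//.
exact: (probability_le1 (power_prob P n) measurableT).
Qed.

(** Chebyshev is applied twice to the distance [h] to [A]: on [A], where [h] vanishes, it bounds the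
    centre [c]; off the neighborhood it bounds the exceptional mass. *)
Lemma hamming_concentration n (A : set (n.-tuple T)) kappa :
  (0 < n)%N -> measurable A -> 0 < kappa -> kappa <= fine (power_prob P n A) ->
  (forall r, measurable [set x | exists2 y, A y & ham x y < r]) ->
  1 - kappa <= fine (power_prob P n
    [set x | exists2 y, A y & ham x y < 2 * Num.sqrt (n%:R / kappa)]).
Proof.
move=> n0 mA k0 kA mN.
have [y0 Ay0] : A !=set0.
  by apply/set0P/eqP => A0; move: (lt_le_trans k0 kA); rewrite A0 measure0 ltxx.
pose S x := [set ham x y | y in A]; pose h x := inf (S x).
have hS x : has_inf (S x).
  split; first by exists (ham x y0), y0.
  by exists 0 => _ [y _ <-]; exact: ham_ge0.
(* The infimum need not be attained, hence strict inequalities: they identify the neighborhoods with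
   the sublevel sets of [h]. *)
have h_lt x r : h x < r <-> exists2 y, A y & ham x y < r.
  split; first by move=> /(inf_lt (hS x).1) [_ [y Ay <-]] ?; exists y.
  by move=> [y Ay]; apply: le_lt_trans; apply: (ge_inf (hS x).2); exists y.
have h0 x : 0 <= h x.
  by apply: (lb_le_inf (hS x).1) => _ [y _ <-]; exact: ham_ge0.
have mh : measurable_fun setT h.
  apply: (measurability _ (RGenInftyO.measurableE R)) => _ [_ [r ->] <-].
  rewrite setTI (_ : _ @^-1` _ = [set x | exists2 y, A y & ham x y < r]).
    exact: mN.
  by apply/seteqP; split => x /=; rewrite in_itv/= => /h_lt.
have hham x y : h x - h y <= ham x y.
  rewrite lerBlDr -lerBlDl; apply: (lb_le_inf (hS y).1) => _ [z Az <-].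
  rewrite lerBlDl; apply: le_trans (ham_triangle y _ _).
  by apply: (ge_inf (hS x).2); exists z.
have [c hc] := hamming_lipschitz_variance mh h0 hham.
set s := Num.sqrt (n%:R / kappa).
have nk0 : 0 < n%:R / kappa by rewrite divr_gt0// ltr0n.
have s0 : 0 < s by rewrite sqrtr_gt0.
have s2 : s ^+ 2 = n%:R / kappa by rewrite sqr_sqrtr// ltW.
have cs : c <= s.
  have hA x : A x -> h x = 0.
    move=> Ax; apply/le_anti; rewrite h0 andbT -(hamxx x).
    by apply: (ge_inf (hS x).2); exists x.
  have cA : c ^+ 2 * fine (power_prob P n A) <= n%:R.
    apply: (second_moment_markov mh mA (sqr_ge0 c) hc) => x /hA ->.
    by rewrite sub0r sqrrN.
  rewrite leNgt; apply/negP => sc.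
  have : s ^+ 2 < c ^+ 2 by rewrite ltr_sqr ?nnegrE ?(ltW s0) ?(ltW (lt_trans s0 sc)).
  rewrite s2 ltr_pdivrMr// ltNge; apply/negP/negPn.
  by apply: le_trans cA; rewrite ler_wpM2l ?sqr_ge0.
(* Off the neighborhood [h >= 2 * s], so [h - c >= s], and [s ^+ 2 = n%:R / kappa] turns the
   variance bound [n] into the mass [kappa]. *)
rewrite lerBlDr -lerBlDl -fine_probC//.
have := second_moment_markov (s := s ^+ 2) mh (measurableC (mN (2 * s))) (sqr_ge0 s) hc.
rewrite s2 mulrAC ler_pdivrMr// ler_pM2l ?ltr0n//; apply => x /=.
rewrite -h_lt => /negP; rewrite -leNgt => hx; rewrite -s2.
by rewrite ler_sqr ?nnegrE ?(ltW s0)//; lra.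
Qed.

End hamming.

(** * Borel measurability, nontriviality and bounds for the invariants *)

Section metric_measure.
Context (R : realType).

Lemma lipschitz_sublevel_open (T : metricType R) (f : T -> R) K r : 0 < K ->
  (forall x y, f x - f y <= K * mdist x y) -> open [set x | f x < r].
Proof.
move=> K0 fK; rewrite openE => x /= xr; apply/nbhs_ballP.
exists ((r - f x) / K); first by rewrite /= divr_gt0// subr_gt0.
move=> y; rewrite ballEmdist/= ltr_pdivlMr// => xy.
by have := fK y x; rewrite metric_sym; lra.
Qed.

Lemma borel_measurable_lipschitz (T : completeMetricType R) (f : T -> R) K : 0 < K ->
  (forall x y, f x - f y <= K * mdist x y) ->
  measurable_fun setT (f : borelType T -> R).
Proof.
move=> K0 fK; apply: (measurability _ (RGenInftyO.measurableE R)) => _ [_ [r ->] <-].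
rewrite setTI; apply: sub_sigma_algebra.
rewrite (_ : _ @^-1` _ = [set x | f x < r]); last first.
  by apply/seteqP; split => x /=; rewrite in_itv.
exact: lipschitz_sublevel_open K0 fK.
Qed.

Lemma mdist_lipschitz (T : metricType R) (a x y : T) :
  mdist a x - mdist a y <= 1 * mdist x y.
Proof.
rewrite mul1r lerBlDr addrC (metric_sym x y); exact: metric_triangle.
Qed.

Lemma measurable_mdist (T : completeMetricType R) (a : T) :
  measurable_fun setT (mdist a : borelType T -> R).
Proof.
by apply: (@borel_measurable_lipschitz _ _ 1) => // x y; exact: mdist_lipschitz.
Qed.

Lemma separable_sequence (X : mmSpace R) : exists s : nat -> X,
  forall x e, 0 < e -> exists k, mdist (s k) x < e.
Proof.
have [D /countable_injP[g ginj] dD] := mm_separable X.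
(* The sequence inverts the injection [g] of the dense set into [nat]; indices outside its image get
   the default [point]. *)
exists (fun k => xget point [set x | D x /\ g x = k]) => x e e0.
have [||y [xy Dy]] := dD (ball x e).
- by exists x; exact: ballxx.
- exact: metric_ball_open.
exists (g y); case: xgetP => [z _ [Dz gzy]|/(_ y)]; last by case.
have -> : z = y by apply: ginj; rewrite ?inE.
by move: xy; rewrite ballEmdist /= metric_sym.
Qed.

(* Otherwise balls of radius 2 e_k of full measure exist for some e_k -> 0, and
   their intersection is a point of full measure. *)
Lemma nontrivial_spread (X : mmSpace R) : nontrivial X ->
  exists (a : X) (al D q : R), [/\ 0 < D, 0 < q,
    q <= fine (mm_prob X ((mdist a : borelType X -> R) @^-1` `]-oo, al])) &
    q <= fine (mm_prob X ((mdist a : borelType X -> R) @^-1` `[al + D, +oo[))].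
Proof.
move=> ntX; apply: contrapT => H; apply: ntX.
set P := mm_prob X.
pose lo (a : X) r : set (borelType X) := (mdist a : borelType X -> R) @^-1` `]-oo, r].
pose hi (a : X) r : set (borelType X) := (mdist a : borelType X -> R) @^-1` `[r, +oo[.
have mlo a r : measurable (lo a r).
  by rewrite -[X in measurable X]setTI; exact: measurable_mdist.
have mhi a r : measurable (hi a r).
  by rewrite -[X in measurable X]setTI; exact: measurable_mdist.
have {}H a r e : 0 < e -> P (lo a r) != 0%E -> P (hi a (r + e)) = 0%E.
  move=> e0 l0; apply/eqP; apply: contrapT => /negP h0; apply: H.
  exists a, r, e, (Num.min (fine (P (lo a r))) (fine (P (hi a (r + e))))).
  have pos A : measurable A -> P A != 0%E -> 0 < fine (P A).
    move=> mA A0; rewrite fine_gt0// lt0e A0 measure_ge0/=.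
    by rewrite -ge0_fin_numE// fin_num_measure.
  by split; rewrite ?ge_min ?lexx ?orbT// lt_min !pos.
have [s sP] := separable_sequence X.
pose e (m : nat) : R := m.+1%:R^-1.
have e0 m : 0 < e m by rewrite invr_gt0.
(* The countably many balls of radius [e m] around the [s k] cover [X], so they cannot all be
   null. *)
have exk m : exists k, P (lo (s k) (e m)) != 0%E.
  apply: contrapT => /forallNP lo0.
  have : P.-negligible (\bigcup_k lo (s k) (e m)).
    apply: negligible_bigcup => k; apply/negligibleP => //.
    by apply/eqP; apply: contrapT => /negP; exact: lo0.
  rewrite (_ : \bigcup_k _ = setT); last first.
    apply/seteqP; split => // x _; have [k sk] := sP x _ (e0 m).
    by exists k => //; rewrite /lo/= in_itv/= ltW.
  move=> /negligibleP => /(_ measurableT) PT0.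
  have := probability_setT P; rewrite PT0 => /eqP.
  by rewrite eq_sym onee_eq0.
pose k m := projT1 (cid (exk m)).
(* A null set; any point off [B] is within [2 * e m] of [s (k m)] for every [m], which leaves room
   for only one point. *)
pose B := \bigcup_m hi (s (k m)) (e m + e m).
have mB : measurable B by apply: bigcupT_measurable.
have PB : P B = 0%E.
  apply/negligibleP => //; apply: negligible_bigcup => m; apply/negligibleP => //.
  by apply: H => //; rewrite /k; case: cid.
have PCB : P (~` B) = 1%E by rewrite probability_setC// PB sube0.
have [x0 Bx0] : (~` B) !=set0.
  by apply/set0P/eqP => B0; move: PCB; rewrite B0 measure0 => /eqP; rewrite eq_sym onee_eq0.
have near_s x : (~` B) x -> forall m, mdist (s (k m)) x < e m + e m.
  move=> Bx m; rewrite ltNge; apply/negP => le; apply: Bx; exists m => //.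
  by rewrite /hi/= in_itv/= andbT.
have x0_only x : (~` B) x -> x = x0.
  move=> Bx; apply: (@mdist_positivity R); apply/eqP.
  rewrite eq_le mdist_ge0 andbT leNgt; apply/negP => xx0.
  (* Both points lie within [2 * e m] of [s (k m)]; [m] is chosen so that [4 * e m] is smaller than
     their distance. *)
  have := truncnS_gt (mdist (x : X) x0 / 4)^-1.
  set m := Num.truncn _ => mm.
  have em : e m < mdist (x : X) x0 / 4.
    by rewrite /e -[ltRHS]invrK ltf_pV2 ?posrE ?invr_gt0// divr_gt0.
  have := metric_triangle x (s (k m)) x0; rewrite (metric_sym x (s (k m))).
  by have := near_s _ Bx m; have := near_s _ Bx0 m; lra.
exists x0 => A mA; rewrite diracE; case: (boolP (x0 \in A)) => [/set_mem Ax0|/negP Ax0].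
  apply/le_anti/andP; split; first exact: probability_le1.
  apply: (@le_trans _ _ (P (~` B))); first by rewrite PCB.
  apply: le_measure; rewrite ?inE//; first exact: measurableC.
  by move=> x /x0_only ->.
rewrite mulr0n; apply/le_anti; rewrite measure_ge0 andbT.
apply: (@le_trans _ _ (P B)); last by rewrite PB.
apply: le_measure; rewrite ?inE// => x Ax; apply: contrapT => /x0_only xx0.
by apply: Ax0; rewrite inE -xx0.
Qed.

Lemma Sep_ge (X : mmSpace R) N (kappa : 'I_N.+1 -> R) (A : 'I_N.+1 -> set X) r :
  (forall i, <<s open>> (A i) /\ ((kappa i)%:E <= mm_prob X (A i))%E) ->
  (forall i j x y, i != j -> A i x -> A j y -> r <= mdist x y) ->
  (r%:E <= Sep X kappa)%E.
Proof.
move=> hA rA; rewrite /Sep.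
apply: (@le_trans _ _ (\big[mine/+oo]_(ij : 'I_N.+1 * 'I_N.+1 | ij.1 != ij.2)
    set_dist (A ij.1) (A ij.2))%E); last first.
  by apply: ereal_sup_ubound; right; exists A.
apply: (big_ind (fun z => r%:E <= z)%E) => [|x y rx ry|[i j]/= ij].
- exact: leey.
- by rewrite le_min rx.
- by apply: le_ereal_inf_tmp => _ [x Ax [y Ay <-]]; rewrite lee_fin (rA i j).
Qed.

Lemma ObsDiam_le (X : mmSpace R) (kappa r : R) : 0 <= r ->
  (forall f : X -> R, lipschitz1 f -> exists b : R,
    ((1 - kappa)%:E <= mm_prob X (f @^-1` [set` `[b, b + r]%R]))%E) ->
  (ObsDiam X kappa <= r%:E)%E.
Proof.
move=> r0 H; apply: ge_ereal_sup => _ [f lf <-]; have [b bf] := H f lf.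
apply: (@le_trans _ _ (diam (`[b, b + r]%classic : set R^o))).
  apply: ereal_inf_lbound; exists `[b, b + r]%classic => //; split => //.
  rewrite -[X in <<s _ >> X]setCK; apply: (@measurableC _ (borelType R^o)).
  apply: sub_sigma_algebra; apply: closed_openC; exact: itv_closed.
apply: ge_ereal_sup => _ [->|[x] xb [y] yb <-]; first by rewrite lee_fin.
move: xb yb; rewrite /= !in_itv/= lee_fin => /andP[? ?] /andP[? ?].
have -> : mdist x y = `|y - x| :> R by [].
by rewrite ler_distl; apply/andP; split; lra.
Qed.

Lemma ObsDiam_ge0 (X : mmSpace R) (kappa : R) : (0 <= ObsDiam X kappa)%E.
Proof.
apply: le_ereal_sup_tmp; eexists.
  by exists (fun=> 0 : R) => //= x y; rewrite subrr normr0 mdist_ge0.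
by apply: le_ereal_inf_tmp => _ [A _ <-]; apply: ereal_sup_ubound; left.
Qed.

End metric_measure.

(** * Measure and distance on the scaled product *)

(** A bridge between two sigma-algebras: [power_prob] lives on the product one, whereas the
    invariants test Borel sets of the scaled metric. *)
Lemma measurable_scaled_lp (R : realType) (X : mmSpace R) (p : \bar R)
    (p1 : (1 <= p)%E) n (t : {posnum R}) (A : set (scale_mm t (lp_mm p1 n X))) :
  <<s open>> A -> measurable (A : set (n.-tuple (borelType X))).
Proof.
rewrite scaled_openE; apply: lp_borel_measurable; exact: mm_separable.
Qed.

Lemma scaled_lpE (R : realType) (X : mmSpace R) (p : \bar R) (p1 : (1 <= p)%E) n
    (t : {posnum R}) (A : set (n.-tuple X)) :
  mm_prob (scale_mm t (lp_mm p1 n X)) A = power_prob (mm_prob X) n A.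
Proof. by []. Qed.

Lemma scaled_lp_mdistE (R : realType) (X : mmSpace R) (p : \bar R)
    (p1 : (1 <= p)%E) n (t : {posnum R}) (x y : scale_mm t (lp_mm p1 n X)) :
  mdist x y = t%:num * lp_norm p (fun i : 'I_n =>
    mdist (tnth (x : n.-tuple X) i) (tnth (y : n.-tuple X) i)).
Proof. by []. Qed.

(* This makes the Hamming distance to an open set measurable; Hamming
   neighborhoods of closed sets need not even be Borel. *)
Lemma hamming_neighborhood_open (R : realType) (X : mmSpace R) (p : \bar R)
    (p1 : (1 <= p)%E) n (t : {posnum R}) (A : set (scale_mm t (lp_mm p1 n X))) r :
  open A -> open ([set x | exists2 y, A y &
    ham R (x : n.-tuple (borelType X)) (y : n.-tuple (borelType X)) < r]
    : set (scale_mm t (lp_mm p1 n X))).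
Proof.
move=> oA; rewrite openE => x [y Ay xyr]; apply/nbhs_ballP.
have /nbhs_ballP[e /= e0 eA] : nbhs y A by exact: open_nbhs_nbhs.
exists e => // z; rewrite ballEmdist/= => xz.
(* [y'] follows [z] where [x] and [y] agree and keeps [y] elsewhere: it is as close to [y] as [z] is
   to [x], and differs from [z] only where [x] differs from [y]. *)
pose y' : n.-tuple X := [tuple if tnth (x : n.-tuple X) i == tnth (y : n.-tuple X) i
  then tnth (z : n.-tuple X) i else tnth (y : n.-tuple X) i | i < n].
exists y'.
  apply: eA; rewrite ballEmdist/=; apply: le_lt_trans xz.
  rewrite !scaled_lp_mdistE ler_pM2l//; apply: le_lp_norm => // i.
    exact: mdist_ge0.
  rewrite tnth_mktuple; case: eqP => [->//|_].
  by rewrite mdistxx mdist_ge0.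
apply: le_lt_trans xyr; apply: ler_sum => i _; rewrite tnth_mktuple ler_nat.
by case: (tnth x i == tnth y i); rewrite ?eqxx// leq_b1.
Qed.

(** Each summand of the [r]-th power is at most [D^r], and it vanishes where the coordinates
    agree. *)
Lemma lp_norm_le_ham (R : realType) (X : mmSpace R) (r : R) n (D : R)
    (x y : n.-tuple (borelType X)) : 1 <= r ->
  (forall a b : X, mdist a b <= D) ->
  lp_norm r%:E (fun i : 'I_n => mdist (tnth x i : X) (tnth y i)) <=
  D * ham R x y `^ r^-1.
Proof.
move=> r1 hD; have r0 : 0 < r by rewrite (lt_le_trans _ r1).
have D0 : 0 <= D by apply: le_trans (hD point point); rewrite mdist_ge0.
have rN0 : r != 0 by rewrite gt_eqF.
apply: (@le_trans _ _ ((D `^ r * ham R x y) `^ r^-1)); last first.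
  by rewrite powRM ?powR_ge0 ?ham_ge0// -powRrM mulfV// powRr1.
apply: ge0_ler_powR; rewrite ?invr_ge0 ?nnegrE ?(ltW r0)//.
- by apply: sumr_ge0 => *; rewrite powR_ge0.
- by rewrite mulr_ge0 ?powR_ge0 ?ham_ge0.
rewrite mulr_sumr; apply: ler_sum => i _.
have [->|_] := eqVneq (tnth x i) (tnth y i).
  by rewrite mdistxx powR0// mulr0.
by rewrite mulr1; apply: ge0_ler_powR; rewrite ?nnegrE ?(ltW r0) ?mdist_ge0.
Qed.

(** * Concentration of Lipschitz functions for finite exponent *)

Section levy.
Context (R : realType) (X : mmSpace R) (r : R) (r1 : (1 <= r%:E)%E).
Variables (n : nat) (t : {posnum R}) (D : R).
Hypotheses (n0 : (0 < n)%N) (D0 : 0 < D) (hD : forall a b : X, mdist a b <= D).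
Local Notation Y := (scale_mm t (lp_mm r1 n X)).
Local Notation Pn := (power_prob (mm_prob X) n).

(** The Hamming radius of [hamming_concentration] converted by [lp_norm_le_ham] into a scaled
    distance; for fixed [kappa] its order is [t n^(1/(2r))]. *)
Definition deviation (kappa : R) : R :=
  t%:num * (D * (2 * Num.sqrt (n%:R / kappa)) `^ r^-1).

Variables (f : Y -> R) (lf : lipschitz1 f).

Let sub (a : R) : set (n.-tuple (borelType X)) := [set x | f x < a].

Let fle x y : f x - f y <= 1 * mdist x y.
Proof. by rewrite mul1r; apply: le_trans (lf x y); exact: ler_norm. Qed.

Let osub a : open ([set x | f x < a] : set Y).
Proof. exact: (lipschitz_sublevel_open a ltr01 fle). Qed.

Let msub a : measurable (sub a).
Proof. by apply: (@measurable_scaled_lp _ X _ r1 n t); apply: sub_sigma_algebra; exact: osub. Qed.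

(** Sublevel sets of [f] are open, so their Hamming neighborhoods are measurable; within the Hamming
    radius [f] grows by at most the deviation. *)
Lemma lipschitz_concentration kappa a : 0 < kappa ->
  kappa <= fine (Pn (sub a)) -> 1 - kappa <= fine (Pn (sub (a + deviation kappa))).
Proof.
move=> k0 ka; have r1' : 1 <= r by rewrite -lee_fin.
have mN s : measurable ([set x | exists2 y, sub a y & ham R x y < s]
    : set (n.-tuple (borelType X))).
  apply: (@measurable_scaled_lp _ X _ r1 n t); apply: sub_sigma_algebra.
  exact: (@hamming_neighborhood_open _ X _ r1 n t _ s (@osub a)).
apply: le_trans (hamming_concentration n0 (@msub a) k0 ka mN) _.
apply: le_fine_prob => // x [y ya xy]; rewrite /sub /=.
have := fle x y; rewrite mul1r scaled_lp_mdistE => h.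
have := lp_norm_le_ham x y r1' hD => h'.
have : t%:num * lp_norm r%:E (fun i : 'I_n => mdist (tnth x i : X) (tnth y i)) <=
    deviation kappa.
  rewrite /deviation ler_pM2l//; apply: le_trans h' _; rewrite ler_pM2l//.
  apply: ge0_ler_powR.
  - by rewrite invr_ge0 (le_trans ler01).
  - by rewrite nnegrE ham_ge0.
  - by rewrite nnegrE mulr_ge0// sqrtr_ge0.
  - exact: ltW.
move=> /(le_trans h); rewrite lerBlDl => /le_lt_trans; apply.
by rewrite ltrD2r.
Qed.

Lemma deviation_gt0 kappa : 0 < kappa -> 0 < deviation kappa.
Proof.
by move=> k0; rewrite !mulr_gt0// powR_gt0// mulr_gt0// sqrtr_gt0 divr_gt0// ltr0n.
Qed.

(** On a grid of step [d], let [a j.+1] be the first point with mass at least [kappa] below it. Then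
    less than [kappa] lies below [a j], and at most [kappa] lies at or above
    [a j.+1 + d = a j + 2 * d]. *)
Lemma lipschitz_concentration_itv kappa : 0 < kappa -> kappa <= 1 ->
  exists b : R, ((1 - 2 * kappa)%:E <=
    Pn (f @^-1` [set` `[b, b + 2 * deviation kappa]%R]))%E.
Proof.
move=> k0 k1; set d := deviation kappa; have d0 : 0 < d := deviation_gt0 k0.
pose x0 : Y := point; pose E := t%:num * (n%:R * D).
have E0 : 0 <= E by rewrite !mulr_ge0// ltW.
have fE x y : f x - f y <= E.
  apply: le_trans (fle x y) _; rewrite mul1r scaled_lp_mdistE ler_pM2l//.
  apply: le_trans (lp_norm_le_sum r1 _) _ => [i|]; first exact: mdist_ge0.
  rewrite mulr_natl -[n in leRHS]card_ord -sumr_const; exact: ler_sum.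
(* [f] oscillates by at most [E], so nothing lies below the grid's first point and the minimal index
   found later is a successor. *)
pose a j := f x0 - E + j%:R * d.
have ex : exists j, kappa <= fine (Pn (sub (a j))).
  exists (Num.truncn ((E + E) / d)).+1; rewrite (_ : sub _ = setT).
    by rewrite probability_setT.
  apply/seteqP; split => // x _; rewrite /sub /a /=.
  have : (E + E) / d < (Num.truncn ((E + E) / d)).+1%:R by exact: truncnS_gt.
  by rewrite ltr_pdivrMr//; have := fE x x0; lra.
case: (ex_minnP ex) => -[|j] kj jmin.
  move: kj; rewrite (_ : sub _ = set0) ?measure0/= ?leNgt ?k0//.
  apply/seteqP; split => // x; rewrite /sub /a/= mul0r addr0.
  by have := fE x0 x; lra.
have jk : fine (Pn (sub (a j))) < kappa.
  by rewrite ltNge; apply/negP => /jmin; rewrite ltnn.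
have := lipschitz_concentration k0 kj; rewrite -/d => kd.
exists (a j).
have mf : measurable (f @^-1` `[a j, a j + 2 * d] : set (n.-tuple (borelType X))).
  apply: (@measurable_scaled_lp _ X _ r1 n t).
  rewrite -[X in <<s _ >> X]setTI.
  by apply: (borel_measurable_lipschitz ltr01 fle).
rewrite -[leRHS]fineK ?fin_num_measure// lee_fin.
suff : fine (Pn (sub (a j.+1 + d))) <=
    fine (Pn (sub (a j))) + fine (Pn (f @^-1` `[a j, a j + 2 * d])) by lra.
rewrite -fineD ?fin_num_measure//.
apply: fine_le; rewrite ?fin_numD ?fin_num_measure//.
apply: le_trans (measureU2 _ _ _) => //.
apply: le_measure; rewrite ?inE//; first exact: measurableU.
move=> x; rewrite /sub/= => h.
have [h'|h'] := ltP (f x) (a j); [by left|right].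
rewrite /= in_itv/= h' /=; apply/ltW/(lt_le_trans h).
by rewrite /a -natr1; lra.
Qed.

End levy.

Lemma ObsDiam_lp_le (R : realType) (X : mmSpace R) (r : R) (r1 : (1 <= r%:E)%E)
    n (t : {posnum R}) (D kappa : R) : (0 < n)%N -> 0 < D ->
  (forall a b : X, mdist a b <= D) -> 0 < kappa ->
  (ObsDiam (scale_mm t (lp_mm r1 n X)) kappa <=
    (2 * deviation r n t D (Num.min kappa 1 / 2))%:E)%E.
Proof.
(* Halving leaves [kappa] for the two tails together, and the cap at 1 meets the condition
   [k <= 1]. *)
move=> n0 D0 hD k0; set k := Num.min kappa 1 / 2.
have k'0 : 0 < k by rewrite divr_gt0// lt_min k0/=.
have kk : 2 * k <= kappa by rewrite mulrC divfK// ge_min lexx.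
have k1 : k <= 1.
  have : 2 * k <= 1 by rewrite mulrC divfK// ge_min lexx orbT.
  lra.
apply: ObsDiam_le; first by rewrite mulr_ge0// ltW// deviation_gt0.
move=> f lf; have [b bk] := lipschitz_concentration_itv n0 D0 hD lf k'0 k1.
exists b; rewrite scaled_lpE; apply: le_trans bk.
by rewrite lee_fin; lra.
Qed.

(** * Lower bounds for the separation distance *)

Section separation.
Context (R : realType) (X : mmSpace R) (D : R).
Hypotheses (ntX : nontrivial X) (hD : forall a b : X, mdist a b <= D).
Local Notation S a m := (psum (mdist a : borelType X -> R) m).

Lemma psum_mdist_diff (a : X) m n (x y : n.-tuple X) :
  S a m y - S a m x <=
  \sum_(i < n) if (i < m)%N then mdist (tnth x i) (tnth y i) else 0.
Proof.
rewrite /psum -sumrB; apply: ler_sum => i _; case: ifP => _; last by rewrite subrr.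
by rewrite lerBlDl; exact: metric_triangle.
Qed.

Lemma psum_mdist_borel (p : \bar R) (p1 : (1 <= p)%E) n (t : {posnum R})
    (a : X) m (B : set R) : measurable B ->
  <<s open>> ([set x : scale_mm t (lp_mm p1 n X) | B (S a m (x : n.-tuple X))]).
Proof.
move=> mB; rewrite -[X in <<s _ >> X]setTI.
(* [n.+1] instead of [n] keeps the Lipschitz constant positive when [n = 0]. *)
apply: (@borel_measurable_lipschitz _ (scale_mm t (lp_mm p1 n X))
  (fun x => S a m (x : n.-tuple X)) (n.+1%:R / t%:num)) => //.
move=> x y; rewrite scaled_lp_mdistE mulrA divfK//.
apply: le_trans (psum_mdist_diff a m (y : n.-tuple X) x) _.
have := @lp_mdist_coord _ _ _ p1 n y x; rewrite metric_sym.
have := mdist_ge0 (x : lp_power X p1 n) y.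
rewrite lp_mdistE; set l := lp_norm _ _; move: l => l l0 yx.
apply: (@le_trans _ _ (n%:R * l)).
  rewrite mulr_natl -[n in leRHS]card_ord -sumr_const; apply: ler_sum => i _.
  by case: ifP => // _; exact: yx.
by rewrite ler_wpM2r// ler_nat.
Qed.

(* Only the first m coordinates are used, which serves p = +oo, where m is kept
   fixed as n grows. *)
Lemma Sep_lp_ge N (kappa : 'I_N.+1 -> R) :
  (forall i, 0 < kappa i) -> \sum_i kappa i < 1 ->
  exists c : R, exists M : nat, [/\ 0 < c, (0 < M)%N &
    forall p (p1 : (1 <= p)%E) m n (t : {posnum R}) rho,
    (M <= m)%N -> (m <= n)%N ->
    (forall x y : n.-tuple X, c * Num.sqrt m%:R <=
        \sum_(i < n) (if (i < m)%N then mdist (tnth x i) (tnth y i) else 0) ->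
      rho <= lp_norm p (fun i : 'I_n => mdist (tnth x i) (tnth y i))) ->
    ((t%:num * rho)%:E <= Sep (scale_mm t (lp_mm p1 n X)) kappa)%E].
Proof.
move=> k0 k1; have [a [al [e [q [e0 q0 qlo qhi]]]]] := nontrivial_spread ntX.
have [|i|c [M [c0 M0 cM]]] := psum_spread (measurable_mdist a) e0 q0 qlo qhi
    (kappa := kappa) (E := D) _ _ k1.
- by move=> x; rewrite mdist_ge0 hD.
- exact: ltW.
exists c, M; split => // p p1 m n t rho Mm mn H.
have [u [v [kuv vu]]] := cM m n Mm mn.
apply: (@Sep_ge R (scale_mm t (lp_mm p1 n X)) N kappa
  (fun i => [set x | [set` `[u i, v i[] (S a m (x : n.-tuple X))])).
  move=> i; split; first exact: psum_mdist_borel.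
  rewrite scaled_lpE -[leRHS]fineK ?lee_fin; first exact: kuv.
  by rewrite fin_num_measure//; apply: measurable_psum_preimage => //; exact: measurable_mdist.
(* The intervals are ordered by index, so symmetry of the metric reduces the claim to [i < j]. *)
suff lt_case (i j : 'I_N.+1) (x y : n.-tuple X) : (i < j)%N ->
    S a m x < v i -> u j <= S a m y ->
    rho <= lp_norm p (fun i : 'I_n => mdist (tnth x i) (tnth y i)).
  move=> i j x y; rewrite /= !in_itv/= neq_ltn => /orP[ij|ji] /andP[ux xv] /andP[uy yv].
    by rewrite scaled_lp_mdistE ler_pM2l// (lt_case i j).
  by rewrite metric_sym scaled_lp_mdistE ler_pM2l// (lt_case j i).
move=> ij xv uy; apply: H; apply: le_trans (psum_mdist_diff a m x y).
by have := vu i j ij; lra.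
Qed.

End separation.

(** * Comparison with the critical rate and conclusion *)

Lemma sqrt_powR_inv (R : realType) (n : nat) (r : R) :
  Num.sqrt n%:R `^ r^-1 = n%:R `^ (2 * r)^-1 :> R.
Proof. by rewrite -powR12_sqrt// -powRrM invfM. Qed.

(** Termwise [a i ^ r >= e ^ (r - 1) * a i]: trivial if [a i = 0], clear if [a i >= e], and an
    equality if [r = 1]. *)
Lemma lp_norm_ge (R : realType) (r e : R) n (a : 'I_n -> R) :
  1 <= r -> 0 < e -> (forall i, 0 <= a i) ->
  (1 < r -> forall i, a i = 0 \/ e <= a i) ->
  (e `^ (r - 1) * \sum_i a i) `^ r^-1 <= lp_norm r%:E a.
Proof.
move=> r1 e0 a0 ae; have r0 : 0 < r by rewrite (lt_le_trans _ r1).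
apply: ge0_ler_powR; rewrite ?invr_ge0 ?(ltW r0)//.
- by rewrite nnegrE mulr_ge0 ?powR_ge0 ?sumr_ge0.
- by rewrite nnegrE sumr_ge0// => i _; rewrite powR_ge0.
rewrite mulr_sumr; apply: ler_sum => i _; rewrite mulrC -[leRHS]mulr_powRB1//.
have [->|ai0] := eqVneq (a i) 0; first by rewrite !mul0r.
rewrite ler_wpM2l//; move: r1; rewrite le_eqVlt => /predU1P[<-|r1].
  by rewrite subrr !powRr0.
case: (ae r1 i) => [ai|ei]; first by rewrite ai eqxx in ai0.
by apply: ge0_ler_powR; rewrite ?nnegrE ?subr_ge0 ?(ltW e0) ?(ltW r1).
Qed.

Theorem corollary1p4 (R : realType) (X : mmSpace R)
    (p : \bar R) (p1 : (1 <= p)%E)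
    (X_nontrivial : nontrivial X)
    (X_bounded : (diam [set: X] < +oo)%E)
    (X_discrete : (1 < p < +oo)%E ->
      (0 < ereal_inf [set (mdist xy.1 xy.2)%:E
                     | xy in [set xy : X * X | xy.1 <> xy.2]])%E)
    (t : nat -> {posnum R}) :
  (critical_rate p n * (t n)%:num @[n --> \oo] --> (0 : R) ->
     Levy_family (fun n => scale_mm (t n) (lp_mm p1 n X))) /\
  (critical_rate p n * (t n)%:num @[n --> \oo] --> +oo ->
     infty_dissipates (fun n => scale_mm (t n) (lp_mm p1 n X))).
Proof.
have [D D0 hD] : exists2 D : R, 0 < D & forall a b : X, mdist a b <= D.
  have dist_le (a b : X) : ((mdist a b)%:E <= diam [set: X])%E.
    by apply: ereal_sup_ubound; right; exists a => //; exists b.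
  have : (0 <= diam [set: X])%E by apply: ereal_sup_ubound; left.
  move: X_bounded dist_le; case: (diam _) => // D _ dist_le; rewrite lee_fin => D0.
  exists (D + 1); first by rewrite ltr_wpDl.
  by move=> a b; have := dist_le a b; rewrite lee_fin => /le_trans; apply; rewrite lerDl.
split.
- move=> rate0 kappa k0.
  have [C hC] : exists C : R, \forall n \near \oo,
      (ObsDiam (scale_mm (t n) (lp_mm p1 n X)) kappa <=
       (C * (critical_rate p n * (t n)%:num))%:E)%E.
    case: p p1 {X_discrete rate0} => [r| |//] p1.
      set k := Num.min kappa 1 / 2.
      have kp : 0 < k by rewrite divr_gt0// lt_min k0/=.
      (* This is twice the deviation with [t n] and the power of [sqrt n] factored out. *)
      exists (2 * (D * (2 * Num.sqrt k^-1) `^ r^-1)).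
      near=> n; have n0 : (0 < n)%N by near: n; exact: nbhs_infty_gt.
      apply: le_trans (ObsDiam_lp_le p1 (t n) n0 D0 hD k0) _; rewrite -/k lee_fin.
      rewrite /deviation /critical_rate -sqrt_powR_inv.
      rewrite sqrtrM// [2 * (Num.sqrt n%:R * _)]mulrCA powRM ?sqrtr_ge0 ?mulr_ge0 ?sqrtr_ge0//.
      rewrite le_eqVlt; apply/orP; left; apply/eqP; ring.
    (* For [p = +oo] the scaled product has diameter at most [t n * D], so an interval of twice that
       length contains all values of [f]. *)
    exists (2 * D); near=> n; apply: ObsDiam_le.
      by rewrite mul1r !mulr_ge0// ltW.
    move=> f lf; exists (f point - (t n)%:num * D).
    rewrite (_ : _ @^-1` _ = setT).
      by rewrite probability_setT lee_fin gerBl ltW.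
    apply/seteqP; split => // x _; rewrite /= in_itv/=.
    have := lf x point; rewrite ler_distl => /andP[].
    have : mdist x point <= (t n)%:num * D.
      rewrite scaled_lp_mdistE ler_pM2l//; apply/bigmax_leP; split; first exact: ltW.
      by move=> i _; exact: hD.
    by rewrite /critical_rate mul1r => h1 h2 h3; apply/andP; split; lra.
  apply: (squeeze_cvge (f := cst 0%E)
    (h := fun n => (C * (critical_rate p n * (t n)%:num))%:E)).
  + by apply: filterS hC => n ->; rewrite ObsDiam_ge0.
  + exact: cvg_cst.
  + apply: cvg_EFin; first by near=> n.
    rewrite -(mulr0 C); apply: cvgM => //; exact: cvg_cst.
- move=> rate_oo N kappa N1 kappa0 sum_kappa.
  have [c [M [c0 M0 hSep]]] := Sep_lp_ge X_nontrivial hD kappa0 sum_kappa.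
  have [C C0 hC] : exists2 C : R, 0 < C & \forall n \near \oo,
      ((C * (critical_rate p n * (t n)%:num))%:E <=
       Sep (scale_mm (t n) (lp_mm p1 n X)) kappa)%E.
    case: p p1 X_discrete {rate_oo} => [r| |//] p1 X_discrete.
      have r1 : 1 <= r by rewrite -lee_fin.
      have [e e0 he] : exists2 e : R, 0 < e &
          (1 < r -> forall a b : X, mdist a b = 0 \/ e <= mdist a b).
        have [r_1|] := ltP 1 r; last by exists 1.
        have := X_discrete; rewrite lte_fin r_1 ltry => /(_ isT).
        set I := ereal_inf _ => I0.
        have Ile (a b : X) : a <> b -> (I <= (mdist a b)%:E)%E.
          by move=> ab; apply: ereal_inf_lbound; exists (a, b).
        (* The cap at 1 makes the infimum a real number. *)
        exists (fine (Order.min I 1%E)).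
          rewrite fine_gt0// lt_min I0 lte01/= gt_min ltry orbT//.
        move=> _ a b; have [->|/eqP ab] := eqVneq a b; first by left; rewrite mdistxx.
        right; rewrite -lee_fin fineK; first by rewrite ge_min Ile.
        by rewrite fin_real// gt_min ltry orbT andbT lt_min !(lt_le_trans (ltNyr 0)) ?(ltW I0).
      exists ((e `^ (r - 1) * c) `^ r^-1).
        by rewrite powR_gt0// mulr_gt0// powR_gt0.
      near=> n; have Mn : (M <= n)%N by near: n; exact: nbhs_infty_ge.
      (* All coordinates are used, [m = n]: sums at least [c sqrt n] give distance at least [rho],
         which is the constant above times [n^(1/(2r))]. *)
      set rho := (e `^ (r - 1) * (c * Num.sqrt n%:R)) `^ r^-1.
      rewrite /critical_rate -sqrt_powR_inv.
      rewrite (_ : _ * _ = (t n)%:num * rho); last first.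
        rewrite /rho [_ * (c * _)]mulrA [in RHS]powRM ?sqrtr_ge0 ?mulr_ge0 ?powR_ge0 ?(ltW c0)//.
        by rewrite [RHS]mulrC mulrA.
      apply: (hSep _ p1 n n) => // x y; under eq_bigr do rewrite ltn_ord.
      move=> xy; apply: le_trans (lp_norm_ge r1 e0 _ _) => [|i|/he]; last 2 first.
      - exact: mdist_ge0.
      - by move=> + i; apply.
      have er0 := powR_ge0 e (r - 1).
      apply: ge0_ler_powR; rewrite ?invr_ge0 ?(le_trans ler01)// ?nnegrE.
      - by rewrite mulr_ge0// mulr_ge0 ?sqrtr_ge0// ltW.
      - by rewrite mulr_ge0// sumr_ge0// => i _; exact: mdist_ge0.
      - by rewrite ler_wpM2l.
    have MR0 : (0 : R) < M%:R by rewrite ltr0n.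
    (* With [m = M] fixed, the maximum is at least the mean of the first [M] coordinate
       distances. *)
    exists (c * Num.sqrt M%:R / M%:R).
      by rewrite divr_gt0// mulr_gt0// sqrtr_gt0.
    near=> n; have Mn : (M <= n)%N by near: n; exact: nbhs_infty_ge.
    rewrite /critical_rate mul1r mulrC; apply: (hSep _ p1 M n) => // x y xy.
    rewrite ler_pdivrMr//; apply: le_trans xy _.
    set L := lp_norm _ _; rewrite -big_mkcond/=.
    apply: (@le_trans _ _ (\sum_(i < n | (i < M)%N) L)).
      apply: ler_sum => i _.
      apply: (lp_norm_coord p1 (a := fun i => mdist (tnth x i) (tnth y i))) => j.
      exact: mdist_ge0.
    by rewrite -(big_ord_widen n (fun=> L) Mn) sumr_const card_ord mulr_natr.
  apply/cvgeyPge => A; have /cvgryPge/(_ (A / C)) := rate_oo.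
  apply: filterS2 hC => n CS; rewrite ler_pdivrMr// => AC.
  by apply: le_trans CS; rewrite lee_fin mulrC.
Unshelve. all: by end_near.
Qed.
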